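(* If $P\subset\mathbb{R}^3$ is an equiprojective polytope, then $P$ is $k$-equiprojective with $$k=\sum_{u}\mu_P(u),$$ where the sum ranges over the edge directions $u$ of $P$.
   Context: A $3$-dimensional polytope $P\subset\mathbb{R}^3$ is $k$-equiprojective when its orthogonal projection onto any plane not orthogonal to a facet of $P$ is a polygon with exactly $k$ vertices; equiprojective means $k$-equiprojective for some $k$. For a face $F$ of a polytope $P\subset\mathbb{R}^3$, $N_P(F)=\{u\in\mathbb{R}^3:\ u\cdot x\le u\cdot y\ \forall x\in P, y\in F\}$. For non-zero $u$, the aggregated cone $C_P(u)$ is the union of the $2$-dimensional normal cones of $P$ contained in the plane $u^\perp$. A vector $u\in\mathbb{S}^2$ is an edge direction of $P$ when its first non-zero coordinate is positive and some edge of $P$ has difference of vertices a multiple of $u$. The multiplicity $\mu_P(u)$ of an edge direction $u$ is $2$ if $C_P(u)=u^\perp$ and $1$ otherwise. *)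

(* Defs.v *)
From HB Require Import structures.
From mathcomp Require Import all_boot all_order all_algebra.
From mathcomp Require Import boolp classical_sets reals.
Set Implicit Arguments. Unset Strict Implicit. Unset Printing Implicit Defensive.
Import Order.TTheory GRing.Theory Num.Theory.
Local Open Scope ring_scope.
Local Open Scope classical_set_scope.

Section Polytopes.
Variable R : realType.

Notation V := 'rV[R]_3.

Definition dotv (u v : V) : R := \sum_(i < 3) u 0 i * v 0 i.

Definition conv (S : seq V) : set V :=
  fun x => exists l : 'I_(size S) -> R,
    (forall i, 0 <= l i) /\ \sum_i l i = 1 /\ x = \sum_i l i *: S`_i.

Definition is_polytope (P : set V) : Prop := exists S : seq V, P = conv S.

Definition lindim_ge (A : set V) (n : nat) : Prop :=
  exists X : seq V, size X = n /\ (forall x, x \in X -> A x) /\ free X.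
Definition lindim (A : set V) (n : nat) : Prop :=
  lindim_ge A n /\ ~ lindim_ge A n.+1.

Definition affdim (A : set V) (n : nat) : Prop :=
  lindim (fun z => exists x y, A x /\ A y /\ z = y - x) n.

Definition face (P F : set V) : Prop :=
  exists u : V, F = (fun x => P x /\ forall y, P y -> dotv u y <= dotv u x).

Definition vertex (P : set V) (x : V) : Prop := face P [set x].
Definition edge (P F : set V) : Prop := face P F /\ affdim F 1.
Definition facet (P F : set V) : Prop := face P F /\ affdim F 2.

Definition perp (u : V) : set V := fun x => dotv u x = 0.
Definition proj (w x : V) : V := x - (dotv x w / dotv w w) *: w.

(* the plane w^perp is orthogonal to (the plane of) the facet F *)
Definition plane_orth_facet (w : V) (F : set V) : Prop :=
  exists n : V, n != 0 /\
    (forall x y, F x -> F y -> dotv n (y - x) = 0) /\ dotv n w = 0.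

Definition has_card (A : set V) (k : nat) : Prop :=
  exists s : seq V, uniq s /\ size s = k /\ forall x, A x <-> x \in s.

Definition k_equiprojective (P : set V) (k : nat) : Prop :=
  forall w : V, w != 0 ->
    (forall F, facet P F -> ~ plane_orth_facet w F) ->
    has_card (vertex (proj w @` P)) k.

Definition equiprojective (P : set V) : Prop := exists k, k_equiprojective P k.

Definition normal_cone (P F : set V) : set V :=
  fun u => forall x y, P x -> F y -> dotv u x <= dotv u y.

Definition agg_cone (P : set V) (u : V) : set V :=
  fun v => exists F, face P F /\ lindim (normal_cone P F) 2 /\
    normal_cone P F `<=` perp u /\ normal_cone P F v.

Definition first_nonzero_pos (u : V) : Prop :=
  exists i : 'I_3, 0 < u 0 i /\ forall j : 'I_3, (j < i)%N -> u 0 j = 0.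

Definition edge_direction (P : set V) (u : V) : Prop :=
  dotv u u = 1 /\ first_nonzero_pos u /\
  exists F, edge P F /\ exists x y, vertex P x /\ vertex P y /\ F x /\ F y /\
    x != y /\ exists t : R, y - x = t *: u.

Definition mult (P : set V) (u : V) : nat :=
  if `[< agg_cone P u = perp u >] then 2%N else 1%N.

End Polytopes.

(* Main.v *)
Require Import Defs.
From HB Require Import structures.
From mathcomp Require Import all_boot all_order all_algebra.
From mathcomp Require Import boolp classical_sets reals.
From mathcomp Require Import ring lra.

(* Let [S] be finite with [P = conv S], and call a point of [S] active in direction
   [v] if it maximizes [v . x] over [S]. Projecting along a generic [w], the edges
   of the polygon are the edges of [P] whose normal cone meets [w^perp]; an edge
   parallel to the unit vector [u] does so in a ray spanned by [u x w] or [- u x w].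
   As a polygon has as many edges as vertices, [k] is the sum over the edge
   directions [u] of [g (u x w)], where [g v] in {0,1,2} counts the signs for which
   [v] or [- v] lies in the aggregated cone of [u], i.e. has two active points.

   On [u^perp], [g] can only jump at normals [n] of facets. Letting [w] cross
   [n^perp] on either side of the line of [u], close to it, changes the terms of
   the other directions in the same way but the term of [u] in opposite ways, so
   constancy of [k] forces the jump of [g] at [n] to vanish. Hence [g] is
   constant at regular points of [u^perp]; the value is positive as [u] is an edge
   direction, and it is 2 exactly when the aggregated cone is all of [u^perp]. *)

Set Implicit Arguments. Unset Strict Implicit. Unset Printing Implicit Defensive.
Import Order.TTheory GRing.Theory Num.Theory.
Local Open Scope ring_scope.

(** * Coordinates and the cross product in space *)

Section Coordinates.
Variable R : realType.
Implicit Types (a b v : 'rV[R]_3) (r : R).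

(** Natural-number indices make every vector identity below a polynomial identity in the atoms
    [crd 0 a], [crd 1 a], [crd 2 a], which [ring] decides. *)
Definition crd (k : nat) v : R := v 0 (inord k).

Definition crossv a b : 'rV[R]_3 :=
  \row_(i < 3) (if nat_of_ord i == 0%N then crd 1 a * crd 2 b - crd 2 a * crd 1 b
           else if nat_of_ord i == 1%N then crd 2 a * crd 0 b - crd 0 a * crd 2 b
           else crd 0 a * crd 1 b - crd 1 a * crd 0 b).

Lemma crdD k a b : crd k (a + b) = crd k a + crd k b.
Proof. by rewrite /crd mxE. Qed.

Lemma crdN k a : crd k (- a) = - crd k a.
Proof. by rewrite /crd mxE. Qed.

Lemma crdZ k r a : crd k (r *: a) = r * crd k a.
Proof. by rewrite /crd mxE. Qed.

Lemma crd0 k : crd k 0 = 0.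
Proof. by rewrite /crd mxE. Qed.

Lemma crd_cross0 a b : crd 0 (crossv a b) = crd 1 a * crd 2 b - crd 2 a * crd 1 b.
Proof. by rewrite {1}/crd mxE inordK. Qed.

Lemma crd_cross1 a b : crd 1 (crossv a b) = crd 2 a * crd 0 b - crd 0 a * crd 2 b.
Proof. by rewrite {1}/crd mxE inordK. Qed.

Lemma crd_cross2 a b : crd 2 (crossv a b) = crd 0 a * crd 1 b - crd 1 a * crd 0 b.
Proof. by rewrite {1}/crd mxE inordK. Qed.

Lemma dotvE a b : dotv a b = crd 0 a * crd 0 b + crd 1 a * crd 1 b + crd 2 a * crd 2 b.
Proof.
rewrite /dotv !big_ord_recl big_ord0 /= addr0 addrA /crd.
have E k (h : (k < 3)%N) (i : 'I_3) : val i = k -> inord k = i.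
  by move=> <-; rewrite inord_val.
by rewrite (E 0%N isT ord0) // (E 1%N isT (lift ord0 ord0)) // (E 2%N isT (lift ord0 (lift ord0 ord0))).
Qed.

Lemma crdP a b : crd 0 a = crd 0 b -> crd 1 a = crd 1 b -> crd 2 a = crd 2 b -> a = b.
Proof.
move=> h0 h1 h2; apply/rowP => i; rewrite -(inord_val i).
by case: i => [[|[|[|]]]].
Qed.

Definition crdE := (crd_cross0, crd_cross1, crd_cross2, crdD, crdN, crdZ, crd0).

End Coordinates.

Ltac vring := first [apply: crdP | idtac]; rewrite ?dotvE ?crdE; ring.

(** * Vector algebra, orthogonal projection and unit directions *)

Section Space.
Variable R : realType.
Implicit Types (a b c d p u v w x y : 'rV[R]_3) (r t : R).

Lemma dotC a b : dotv a b = dotv b a. Proof. vring. Qed.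
Lemma dotDl a b c : dotv (a + b) c = dotv a c + dotv b c. Proof. vring. Qed.
Lemma dotDr a b c : dotv a (b + c) = dotv a b + dotv a c. Proof. vring. Qed.
Lemma dotNl a b : dotv (- a) b = - dotv a b. Proof. vring. Qed.
Lemma dotNr a b : dotv a (- b) = - dotv a b. Proof. vring. Qed.
Lemma dotBl a b c : dotv (a - b) c = dotv a c - dotv b c. Proof. vring. Qed.
Lemma dotBr a b c : dotv a (b - c) = dotv a b - dotv a c. Proof. vring. Qed.
Lemma dotZl r a b : dotv (r *: a) b = r * dotv a b. Proof. vring. Qed.
Lemma dotZr r a b : dotv a (r *: b) = r * dotv a b. Proof. vring. Qed.
Lemma dot0l a : dotv 0 a = 0. Proof. vring. Qed.
Lemma dot0r a : dotv a 0 = 0. Proof. vring. Qed.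

Lemma crossC a b : crossv a b = - crossv b a. Proof. vring. Qed.
Lemma crossDl a b c : crossv (a + b) c = crossv a c + crossv b c. Proof. vring. Qed.
Lemma crossDr a b c : crossv a (b + c) = crossv a b + crossv a c. Proof. vring. Qed.
Lemma crossNl a b : crossv (- a) b = - crossv a b. Proof. vring. Qed.
Lemma crossNr a b : crossv a (- b) = - crossv a b. Proof. vring. Qed.
Lemma crossZl r a b : crossv (r *: a) b = r *: crossv a b. Proof. vring. Qed.
Lemma crossZr r a b : crossv a (r *: b) = r *: crossv a b. Proof. vring. Qed.
Lemma cross0l a : crossv 0 a = 0. Proof. vring. Qed.
Lemma crossvv a : crossv a a = 0. Proof. vring. Qed.
Lemma dot_crossl a b : dotv a (crossv a b) = 0. Proof. vring. Qed.
Lemma dot_crossr a b : dotv b (crossv a b) = 0. Proof. vring. Qed.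
Lemma triple_rot a b c : dotv a (crossv b c) = dotv c (crossv a b). Proof. vring. Qed.
Lemma cross_cross a b c : crossv a (crossv b c) = dotv a c *: b - dotv a b *: c.
Proof. vring. Qed.
Lemma dot_cross_cross a b :
  dotv (crossv a b) (crossv a b) = dotv a a * dotv b b - dotv a b ^+ 2.
Proof. vring. Qed.

Lemma dot_ge0 a : 0 <= dotv a a.
Proof. by rewrite dotvE -!expr2 !addr_ge0 ?sqr_ge0. Qed.

Lemma dot_eq0 a : dotv a a = 0 -> a = 0.
Proof.
rewrite dotvE => h.
have [h0 [h1 h2]] : crd 0 a = 0 /\ crd 1 a = 0 /\ crd 2 a = 0.
  by split; [|split]; nra.
by apply: crdP; rewrite crd0.
Qed.

Lemma dot_gt0 a : a != 0 -> 0 < dotv a a.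
Proof. by move=> h; rewrite lt_def dot_ge0 andbT; apply: contra_neq h => /dot_eq0. Qed.

Lemma cross_eq0P a b : b != 0 -> crossv a b = 0 -> a = (dotv a b / dotv b b) *: b.
Proof.
move=> /dot_gt0 hb hc.
have : crossv b (crossv a b) = 0 by rewrite hc; vring.
rewrite cross_cross (dotC b a) => /eqP; rewrite subr_eq0 => /eqP h.
rewrite mulrC -scalerA -h scalerA mulVf ?scale1r //; exact: lt0r_neq0.
Qed.

(** The double cross product of [p] with [crossv a b] expands into multiples of [a] and [b] whose
    coefficients vanish. *)
Lemma orth2_cross p a b : crossv a b != 0 -> dotv p a = 0 -> dotv p b = 0 ->
  p = (dotv p (crossv a b) / dotv (crossv a b) (crossv a b)) *: crossv a b.
Proof.
move=> h pa pb; apply: cross_eq0P => //.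
by rewrite cross_cross pa pb !scale0r subrr.
Qed.

Lemma unit_neq0 u : dotv u u = 1 -> u != 0.
Proof. by apply: contra_eq_neq => ->; rewrite dot0l eq_sym oner_eq0. Qed.

Lemma exists_orth u : u != 0 -> exists v, v != 0 /\ dotv v u = 0.
Proof.
move=> hu; pose e (k : nat) : 'rV[R]_3 := \row_i (if nat_of_ord i == k then 1 else 0).
have ee k j : (j < 3)%N -> crd j (e k) = (if j == k then 1 else 0).
  by move=> h; rewrite /crd mxE inordK.
case: (eqVneq (crossv u (e 0%N)) 0) => [h0|]; last first.
  by move=> h; exists (crossv u (e 0%N)); rewrite dotC dot_crossl.
case: (eqVneq (crossv u (e 1%N)) 0) => [h1|]; last first.
  by move=> h; exists (crossv u (e 1%N)); rewrite dotC dot_crossl.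
case/eqP: hu; have E0 k : crd k (crossv u (e 0%N)) = 0 by rewrite h0 crd0.
have E1 k : crd k (crossv u (e 1%N)) = 0 by rewrite h1 crd0.
move: (E0 1%N) (E0 2%N) (E1 2%N); rewrite !crdE !ee //= => a1 a2 a3.
by apply: crdP; rewrite crd0; lra.
Qed.

(** Self-adjointness turns maximizing [u] over the projected polytope into maximizing [proj w u]
    over the polytope itself. *)
Lemma projE w u x : dotv u (proj w x) = dotv (proj w u) x.
Proof. by rewrite /proj dotBr dotBl dotZr dotZl (dotC u w) (dotC x w); ring. Qed.

Lemma proj_orth w u : w != 0 -> dotv (proj w u) w = 0.
Proof.
move=> /dot_gt0/lt0r_neq0 h; rewrite /proj dotBl dotZl mulfVK // subrr //.
Qed.

Lemma proj_id w u : dotv u w = 0 -> proj w u = u.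
Proof. by move=> h; rewrite /proj h mul0r scale0r subr0. Qed.

Lemma proj_eq w x y : proj w x = proj w y -> crossv (x - y) w = 0.
Proof.
rewrite /proj => h.
have -> : x - y = (dotv x w / dotv w w - dotv y w / dotv w w) *: w.
  rewrite scalerBl; move/(congr1 (fun z => z + (dotv x w / dotv w w) *: w - y)): h.
  by rewrite subrK => ->; rewrite addrAC [_ - _ - y]addrAC subrr sub0r addrC.
by rewrite crossZl crossvv scaler0.
Qed.

Lemma free2P a b : free [:: a; b] <-> crossv a b != 0.
Proof.
split.
  move=> fr; apply: contraTneq fr => h.
  case: (eqVneq b 0) => [->|nb].
    by rewrite free_cons (negbTE (_ : ~~ free [:: 0])) ?andbF // free_cons mem0v.
  rewrite (cross_eq0P nb h) free_cons span_seq1 memvZ // memv_line //.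
move=> h; rewrite free_cons; apply/andP; split.
  rewrite span_seq1; apply: contraNN h => /vlineP[t ->].
  by rewrite crossZl crossvv scaler0.
rewrite free_cons span_nil memv0 nil_free andbT.
by apply: contraNN h => /eqP->; rewrite crossC cross0l oppr0.
Qed.

Lemma free3_orth (X : seq 'rV[R]_3) v : free X -> size X = 3%N ->
  (forall x, x \in X -> dotv v x = 0) -> v = 0.
Proof.
move=> fr sX h; apply: dot_eq0.
have bX : basis_of fullv X.
  by rewrite basisEfree fr subvf dimvf /= /dim /= sX.
have [c vE] : exists c : 'I_(size X) -> R, v = \sum_i c i *: X`_i.
  have vX : v \in <<in_tuple X>>%VS by rewrite (span_basis bX) memvf.
  by exists (fun i => coord (in_tuple X) i v); rewrite {1}(coord_span vX).
rewrite {2}vE; elim/big_ind: _ => [|x y hx hy|i _].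
- by rewrite dot0r.
- by rewrite dotDr hx hy addr0.
- by rewrite dotZr h ?mulr0 // mem_nth.
Qed.

Lemma normalize_dir d : d != 0 -> exists t u,
  [/\ t != 0, u = t *: d, dotv u u = 1 & first_nonzero_pos u].
Proof.
move=> nd; have dd := dot_gt0 nd.
pose q := Num.sqrt (dotv d d).
have q0 : 0 < q by rewrite sqrtr_gt0.
have qq : q * q = dotv d d by rewrite -expr2 sqr_sqrtr // ltW.
have [i di dj] : exists2 i : 'I_3, d 0 i != 0 & forall j : 'I_3, (j < i)%N -> d 0 j = 0.
  have [i0 hi0] : exists i : 'I_3, d 0 i != 0.
    apply/existsP; apply: contraNT nd; rewrite negb_exists => /forallP h.
    by apply/eqP/rowP => i; rewrite mxE; apply/eqP; move: (h i); rewrite negbK.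
  case: (@arg_minnP _ i0 (fun i : 'I_3 => d 0 i != 0) (fun i => val i) hi0) => i hi hm.
  exists i => // j ji; apply/eqP/negPn/negP => /hm /=; by rewrite leqNgt ji.
(* The sign of the first non-zero coordinate selects one of the two unit vectors on the line of
   [d]. *)
pose t := Num.sg (d 0 i) / q.
have tn : t != 0 by rewrite mulf_neq0 ?sgr_eq0 ?di // invr_eq0 lt0r_neq0.
exists t, (t *: d); split => //.
  rewrite dotZl dotZr -qq /t.
  have sg1 : Num.sg (d 0 i) ^+ 2 = 1 by rewrite sqr_sg di.
  transitivity (Num.sg (d 0 i) ^+ 2 * (q^-1 * q) ^+ 2); first by ring.
  by rewrite sg1 mulVf ?lt0r_neq0 // expr1n mulr1.
exists i; split; last by move=> j ji; rewrite mxE dj // mulr0.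
by rewrite mxE /t mulrAC -normrEsg divr_gt0 // normr_gt0.
Qed.

Lemma first_nonzero_pos_opp u : first_nonzero_pos u -> ~ first_nonzero_pos (- u).
Proof.
move=> [i [ui uj]] [j [uj' ui']].
rewrite mxE oppr_gt0 in uj'.
case: (ltngtP i j) => ij.
- by move: (ui' i ij); rewrite mxE => /eqP; rewrite oppr_eq0 (gt_eqF ui).
- by rewrite uj // ltxx in uj'.
- by rewrite (ord_inj ij) in ui; move: (lt_trans ui uj'); rewrite ltxx.
Qed.

Lemma parallel_unit u v : dotv u u = 1 -> dotv v v = 1 -> crossv u v = 0 ->
  u = v \/ u = - v.
Proof.
move=> uu vv h.
have := cross_eq0P (unit_neq0 vv) h; rewrite vv divr1 => uE.
have : dotv u v ^+ 2 = 1.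
  by have := dot_cross_cross u v; rewrite h uu vv dot0l mulr1 => /esym/eqP; rewrite subr_eq0 => /eqP.
move/eqP; rewrite sqrf_eq1 => /orP[]/eqP h2; rewrite uE h2.
  by left; rewrite scale1r.
by right; rewrite scaleN1r.
Qed.

End Space.

(** * Properties valid for all small positive parameters, and a connectedness argument *)

Section Eventually.
Variable R : realType.

(** Germs at 0 from the right; closure under finite conjunctions replaces explicit bookkeeping of
    radii. *)
Definition ev (Q : R -> Prop) : Prop :=
  exists2 r : R, 0 < r & forall t, 0 < t < r -> Q t.

Lemma ev_all (Q : R -> Prop) : (forall t, 0 < t -> Q t) -> ev Q.
Proof. by move=> h; exists 1 => // t /andP[/h]. Qed.

Lemma evI (Q1 Q2 : R -> Prop) : ev Q1 -> ev Q2 -> ev (fun t => Q1 t /\ Q2 t).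
Proof.
move=> [r1 r10 h1] [r2 r20 h2]; exists (Num.min r1 r2); first by rewrite lt_min r10.
by move=> t /andP[t0]; rewrite lt_min => /andP[t1 t2]; split; [apply: h1|apply: h2]; rewrite t0.
Qed.

Lemma ev_mono (Q1 Q2 : R -> Prop) : (forall t, 0 < t -> Q1 t -> Q2 t) -> ev Q1 -> ev Q2.
Proof. by move=> h [r r0 hr]; exists r => // t tr; apply: h; [case/andP: tr|apply: hr]. Qed.

Lemma ev_ex (Q : R -> Prop) : ev Q -> exists2 t, 0 < t & Q t.
Proof.
move=> [r r0 h]; exists (r / 2); first by rewrite divr_gt0.
by apply: h; rewrite divr_gt0 //= ltr_pdivrMr // ltr_pMr // ltr1n.
Qed.

Lemma ev_seq (T : eqType) (s : seq T) (Q : T -> R -> Prop) :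
  (forall x, x \in s -> ev (Q x)) -> ev (fun t => forall x, x \in s -> Q x t).
Proof.
elim: s => [|y s IH] h; first by apply: ev_all.
have h1 := h y (mem_head _ _).
have h2 : ev (fun t => forall x, x \in s -> Q x t).
  by apply: IH => x xs; apply: h; rewrite in_cons xs orbT.
apply: ev_mono (evI h1 h2) => t _ [q1 q2] x; rewrite in_cons => /orP[/eqP->|] //.
exact: q2.
Qed.

Lemma ev_scale (c : R) (Q : R -> Prop) : 0 < c -> ev Q -> ev (fun t => Q (c * t)).
Proof.
move=> c0 [r r0 h]; exists (r / c); first by rewrite divr_gt0.
by move=> t /andP[t0 tr]; apply: h; rewrite mulr_gt0 //= mulrC -ltr_pdivlMr.
Qed.

Lemma ev_lin_gt0 (a b : R) : 0 < a -> ev (fun t => 0 < a + t * b).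
Proof.
move=> a0; have b1 : 0 < 1 + `|b| by rewrite ltr_pwDl.
exists (a / (1 + `|b|)); first by rewrite divr_gt0.
move=> t /andP[t0]; rewrite ltr_pdivlMr // => h.
have : - (t * b) <= t * `|b| 
  by rewrite -mulrN ler_wpM2l ?(ltW t0) // -normrN ler_norm.
by nra.
Qed.

Lemma ev_lin_lt0 (a b : R) : a < 0 -> ev (fun t => a + t * b < 0).
Proof.
move=> a0; have := @ev_lin_gt0 (- a) (- b); rewrite oppr_gt0 => /(_ a0).
by apply: ev_mono => t _; nra.
Qed.

Lemma ev_lin_neq0 (a b : R) : (a = 0 -> b != 0) -> ev (fun t => a + t * b != 0).
Proof.
case: (ltgtP a 0) => [a0|a0|->] h.
- by apply: ev_mono (ev_lin_lt0 b a0) => t _ /lt_eqF->.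
- by apply: ev_mono (ev_lin_gt0 b a0) => t _ /gt_eqF->.
- by apply: ev_all => t t0; rewrite add0r mulf_neq0 ?h // gt_eqF.
Qed.

Lemma seq_max (T : eqType) (s : seq T) (f : T -> R) x0 : x0 \in s ->
  exists2 x, x \in s & forall y, y \in s -> f y <= f x.
Proof.
elim: s x0 => // a s IH x0 _; case: s IH => [|b s] IH.
  by exists a; rewrite ?mem_head // => y; rewrite inE => /eqP->.
have [x xs hx] := IH b (mem_head _ _).
case: (leP (f a) (f x)) => h.
  by exists x => [|y]; rewrite in_cons ?xs ?orbT // => /orP[/eqP->|/hx].
exists a; first exact: mem_head.
by move=> y; rewrite in_cons => /orP[/eqP->|/hx] // /le_trans -> //; apply: ltW.
Qed.

(** Here [c t] is the common one-sided limit of [f] at [t], while [f t] itself is unconstrained. The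
    limit function is locally constant, hence constant on the connected interval [0, 1]. *)
Lemma punctured_limit_const (f c : R -> nat) :
  (forall t, ev (fun h => f (t + h) = c t)) ->
  (forall t, ev (fun h => f (t - h) = c t)) -> c 0 = c 1.
Proof.
move=> fr fl.
(* For [s] close to [t], a point between them and very close to [s] gives a value of [f] equal to
   both [c s] and [c t]. *)
have loc t : exists2 r : R, 0 < r & forall s : R, `|s - t| < r -> c s = c t.
  have [r r0 h] := evI (fr t) (fl t); exists r => // s.
  case: (ltgtP s t) => [st|ts|-> //] sr.
    have := evI (fr s) (ev_lin_gt0 (-1) (_ : 0 < t - s)); rewrite subr_gt0 => /(_ st).
    move=> /ev_ex[q q0 [<- q1]].
    have [|_ <-] := h (t - s - q).
      by move: sr; rewrite ltr0_norm ?subr_lt0 // => sr; apply/andP; split; lra.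
    by congr f; lra.
  have := evI (fl s) (ev_lin_gt0 (-1) (_ : 0 < s - t)); rewrite subr_gt0 => /(_ ts).
  move=> /ev_ex[q q0 [<- q1]].
  have [|<- _] := h (s - t - q).
    by move: sr; rewrite gtr0_norm ?subr_gt0 // => sr; apply/andP; split; lra.
  by congr f; lra.
pose E : set R := fun t => 0 <= t <= 1 /\ forall s : R, 0 <= s <= t -> c s = c 0.
have E0 : E 0.
  split; first by rewrite lexx ler01.
  by move=> s; rewrite -eq_le => /eqP<-.
have Eub : ubound E 1 by move=> t [/andP[]].
have hsE : has_sup E by split; [exists 0|exists 1].
set T := sup E.
have T0 : 0 <= T by apply: ub_le_sup => //; exists 1.
have T1 : T <= 1 by apply: ge_sup => //; exists 0.
have [r r0 hr] := loc T.
have [t [t01 tE] tT] := sup_adherent r0 hsE; rewrite -/T in tT.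
have tleT : t <= T by apply: ub_le_sup; [exists 1|split].
have cT : c T = c 0.
  rewrite -(hr t); last by rewrite ler0_norm ?subr_le0 //; lra.
  by apply: tE; case/andP: t01 => -> _ /=.
have below s : 0 <= s -> s < T + r -> c s = c 0.
  move=> s0 sT; case: (leP s t) => st; first by apply: tE; rewrite s0.
  rewrite hr // ltr_norml; apply/andP; split; lra.
case: (ltP T 1) => [Tlt|]; last by move=> h; rewrite below //; lra.
pose q := Num.min (T + r / 2) 1.
have qE : E q.
  split; first by rewrite le_min ge_min lexx orbT ler01 !andbT; lra.
  move=> s /andP[s0 sq]; apply: below => //; apply: (le_lt_trans sq).
  by rewrite gt_min; apply/orP; left; lra.
have : q <= T by apply: ub_le_sup => //; exists 1.
by rewrite ge_min => /orP[] ?; exfalso; lra.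
Qed.

End Eventually.

(** * Active points and the faces of a convex hull *)

Section ActivePoints.
Variable R : realType.
Variable S : seq 'rV[R]_3.
Implicit Types (a b c d e n p q u v w x y z : 'rV[R]_3) (r t : R).

Definition act v x : bool := (x \in S) && all (fun y => dotv v y <= dotv v x) S.

(** The list [S] may have repetitions, so two distinct active points are required: the face in
    direction [v] is not a single point. *)
Definition nontriv v : bool :=
  has (fun a => has (fun b => [&& a != b, act v a & act v b]) S) S.

(** A single active point is allowed; together with [nontriv] the condition says that the face is an
    edge parallel to [u], when [u] is non-zero. *)
Definition act_parallel v u : Prop :=
  forall a b, act v a -> act v b -> crossv (a - b) u = 0.

Lemma actP v x : act v x <-> x \in S /\ forall y, y \in S -> dotv v y <= dotv v x.
Proof.
rewrite /act; split; first by case/andP => -> /allP.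
by case=> -> h; apply/allP.
Qed.

Lemma act_mem v x : act v x -> x \in S.
Proof. by case/andP. Qed.

Lemma act_ge v x y : act v x -> y \in S -> dotv v y <= dotv v x.
Proof. by move/actP => [_]; apply. Qed.

Lemma nontrivP v : nontriv v <-> exists a b, [/\ a != b, act v a & act v b].
Proof.
split; first by case/hasP => a _ /hasP[b _ /and3P[h1 h2 h3]]; exists a, b.
move=> [a [b [h1 h2 h3]]]; apply/hasP; exists a; first exact: act_mem h2.
by apply/hasP; exists b; [exact: act_mem h3|apply/and3P].
Qed.

Lemma act_exists v x : x \in S -> exists y, act v y.
Proof. by move/(seq_max (dotv v)) => [y yS hy]; exists y; apply/actP. Qed.

Lemma act_eq v a b : act v a -> act v b -> dotv v a = dotv v b.
Proof.
by move=> ha hb; apply/eqP; rewrite eq_le (act_ge ha) ?(act_ge hb) ?(act_mem ha) ?(act_mem hb).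
Qed.

Lemma act_of_eq v a b : act v a -> b \in S -> dotv v a = dotv v b -> act v b.
Proof. by move=> ha bS e; apply/actP; split=> // y /(act_ge ha); rewrite e. Qed.

Lemma act_lt v a b : act v a -> b \in S -> ~~ act v b -> dotv v b < dotv v a.
Proof.
move=> ha bS hb; rewrite lt_def (act_ge ha bS) andbT.
by apply: contraNneq hb => e; apply: act_of_eq ha bS e.
Qed.

Lemma act_diff_ge0 v a b : act v a -> b \in S -> 0 <= dotv v (a - b).
Proof. by move=> ha bS; rewrite dotBr subr_ge0 act_ge. Qed.

Lemma act_diff0 v a b : act v a -> act v b -> dotv v (a - b) = 0.
Proof. by move=> ha hb; rewrite dotBr (act_eq ha hb) subrr. Qed.

(** The strict inequalities that exclude the finitely many inactive points survive a small tilt, so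
    a tilt can only lose active points. *)
Lemma act_perturb v d : ev (fun t => forall x, act (v + t *: d) x -> act v x).
Proof.
have : ev (fun t => forall x, x \in S -> act (v + t *: d) x -> act v x).
  apply: ev_seq => x xS.
  have [hx|hx] := boolP (act v x); first by apply: ev_all.
  have [a ha] := act_exists v xS.
  have h := act_lt ha xS hx.
  have h' : 0 < dotv v (a - x) by rewrite dotBr subr_gt0.
  apply: ev_mono (ev_lin_gt0 (dotv d (a - x)) h') => t _ h2 /act_ge/(_ (act_mem ha)).
  by rewrite leNgt -subr_gt0 -dotBr dotDl dotZl h2.
by apply: ev_mono => t _ h x hx; apply: h => //; apply: act_mem hx.
Qed.

Lemma act_cmp v v' :
  (forall a b, a \in S -> b \in S -> (dotv v b <= dotv v a) = (dotv v' b <= dotv v' a)) ->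
  act v =1 act v'.
Proof.
move=> h x; rewrite /act; case xS: (x \in S) => //=.
by apply: eq_in_all => y yS; apply: h.
Qed.

Lemma nontriv_eq v v' : act v =1 act v' -> nontriv v = nontriv v'.
Proof.
by move=> h; rewrite /nontriv; apply: eq_has => a; apply: eq_has => b; rewrite !h.
Qed.

Lemma nontriv_sub v v' : (forall x, act v x -> act v' x) -> nontriv v -> nontriv v'.
Proof.
move=> h /nontrivP[a [b [ab ha hb]]]; apply/nontrivP; exists a, b; split => //; exact: h.
Qed.

Lemma act_scale t v : 0 < t -> act (t *: v) =1 act v.
Proof. by move=> t0; apply: act_cmp => a b _ _; rewrite !dotZl ler_pM2l. Qed.

Lemma trivial_act v x y : ~~ nontriv v -> act v x -> act v y -> x = y.
Proof.
move=> h hx hy; apply/eqP/negPn/negP => xy; case/negP: h.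
by apply/nontrivP; exists x, y.
Qed.

(** Convertible to the set in the definition of [face], so that every face takes this form at
    once. *)
Definition maxface (P : set 'rV[R]_3) v : set 'rV[R]_3 :=
  fun x => P x /\ forall y, P y -> dotv v y <= dotv v x.

Lemma dot_sum v (I : finType) (f : I -> 'rV[R]_3) :
  dotv v (\sum_i f i) = \sum_i dotv v (f i).
Proof. by apply: (big_morph (dotv v)) => [x y|]; rewrite ?dotDr ?dot0r. Qed.

Lemma conv_mem x : x \in S -> conv S x.
Proof.
move=> xS; have hx : (index x S < size S)%N by rewrite index_mem.
exists (fun i => (i == Ordinal hx)%:R); split; first by move=> i; rewrite ler0n.
split.
  by rewrite (bigD1 (Ordinal hx)) //= eqxx big1 ?addr0 // => i /negbTE ->.
rewrite (bigD1 (Ordinal hx)) //= eqxx scale1r nth_index // big1 ?addr0 //.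
by move=> i /negbTE ->; rewrite scale0r.
Qed.

Lemma conv_le v x r : (forall y, y \in S -> dotv v y <= r) -> conv S x -> dotv v x <= r.
Proof.
move=> h [l [l0 [l1 ->]]]; rewrite dot_sum -[r]mul1r -l1 mulr_suml.
by apply: ler_sum => i _; rewrite dotZr ler_wpM2l // h // mem_nth.
Qed.

Lemma act_maxface v x : act v x -> maxface (conv S) v x.
Proof.
move=> hx; split; first by apply: conv_mem; apply: act_mem hx.
by move=> y; apply: conv_le => z; apply: act_ge.
Qed.

(* A point of the face in direction [v] has zero weight on the inactive points. *)
Lemma maxface_le v x q r : maxface (conv S) v x ->
  (forall y, act v y -> dotv q y <= r) -> dotv q x <= r.
Proof.
move=> [[l [l0 [l1 xE]]] xm] h.
have key i : l i = 0 \/ act v S`_i.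
  have iS : S`_i \in S by rewrite mem_nth.
  have [|hi] := boolP (act v S`_i); [by right|left].
  have [a ha] := act_exists v iS.
  have hlt := act_lt ha iS hi.
  have : dotv v a <= dotv v x by apply: xm; apply: conv_mem; apply: act_mem ha.
  have -> : dotv v x = dotv v a - \sum_j l j * (dotv v a - dotv v S`_j).
    rewrite xE dot_sum -[X in X - _]mul1r -l1 mulr_suml -sumrB.
    by apply: eq_bigr => j _; rewrite dotZr; ring.
  rewrite lerBrDr gerDl (bigD1 i) //= => hs.
  have : 0 <= \sum_(j < size S | j != i) l j * (dotv v a - dotv v S`_j).
    by apply: sumr_ge0 => j _; rewrite mulr_ge0 // subr_ge0 (act_ge ha) // mem_nth.
  move=> hs2; have hi0 : l i * (dotv v a - dotv v S`_i) <= 0 by lra.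
  have d0 : 0 < dotv v a - dotv v S`_i by rewrite subr_gt0.
  apply/eqP; rewrite eq_le l0 andbT; rewrite pmulr_lle0 // in hi0.
rewrite xE dot_sum -[r]mul1r -l1 mulr_suml.
apply: ler_sum => i _; rewrite dotZr.
by case: (key i) => [->|/h hi]; rewrite ?mul0r // ler_wpM2l.
Qed.

Lemma maxface_eq v x q r : maxface (conv S) v x ->
  (forall y, act v y -> dotv q y = r) -> dotv q x = r.
Proof.
move=> hx h; apply/eqP; rewrite eq_le (maxface_le hx) /=; last by move=> y /h ->.
by rewrite -lerN2 -dotNl (maxface_le hx) // => y /h; rewrite dotNl => ->.
Qed.

(** With [m] the cross product to be killed, the functional [crossv u m] is constant on the active
    points, hence on the face; its value on [x - a] is the squared norm of [m]. *)
Lemma maxface_parallel v u x a : maxface (conv S) v x -> act v a ->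
  (forall y, act v y -> crossv (y - a) u = 0) -> crossv (x - a) u = 0.
Proof.
move=> hx ha h; apply: dot_eq0; set m := crossv (x - a) u.
have : dotv (crossv u m) x = dotv (crossv u m) a.
  apply: (maxface_eq hx) => y /h hy; apply/eqP; rewrite -subr_eq0 -dotBr; apply/eqP.
  by rewrite dotC triple_rot hy dot0r.
move/eqP; rewrite -subr_eq0 -dotBr dotC triple_rot => /eqP <-; by [].
Qed.

Lemma maxface_single v x a : maxface (conv S) v x ->
  (forall y, act v y -> y = a) -> x = a.
Proof.
move=> hx h; apply/eqP; rewrite -subr_eq0; apply/eqP/dot_eq0.
rewrite dotBr; apply/eqP; rewrite subr_eq0; apply/eqP.
by apply: (maxface_eq hx) => y /h ->.
Qed.

Lemma act_vertex v x : act v x -> (forall y, act v y -> y = x) -> vertex (conv S) x.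
Proof.
move=> hx h; exists v; apply/seteqP; split => y /=.
  by move=> ->; apply: act_maxface.
by move=> hy; apply: (maxface_single hy).
Qed.

End ActivePoints.

(** * Full-dimensional point sets *)

Section FullDimensional.
Variable R : realType.
Variable S : seq 'rV[R]_3.
Implicit Types (a b c d e n p q u v w x y z : 'rV[R]_3) (r t : R).

(** Full dimension of [conv S] in dual form, ready to be applied to a functional without choosing an
    affine basis. *)
Definition spanning : Prop :=
  forall v, v != 0 -> exists a b, [/\ a \in S, b \in S & dotv v (a - b) != 0].

(** A functional constant on [S] is constant on the hull, hence kills three independent differences
    and vanishes. *)
Lemma affdim3_spanning : affdim (conv S) 3 -> spanning.
Proof.
move=> [[X [sX [hX fX]]] _] v nv; apply: contrapT => hn.
have h a b : a \in S -> b \in S -> dotv v (a - b) = 0.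
  by move=> aS bS; apply: contrapT => h; apply: hn; exists a, b; split => //; apply/eqP.
move/eqP: nv; apply; apply: (free3_orth fX sX) => x /hX [y [z [hy [hz ->]]]].
have hv q : conv S q -> forall s0, s0 \in S -> dotv v q = dotv v s0.
  move=> hq s0 s0S; apply/eqP; rewrite eq_le; apply/andP; split.
    by apply: conv_le hq => q' q'S; rewrite -subr_le0 -dotBr h.
  rewrite -lerN2 -dotNl; apply: conv_le hq => q' q'S.
  by rewrite dotNl lerN2 -subr_le0 -dotBr h.
have [s0 s0S] : exists s0, s0 \in S.
  case: (S) hy => [[l [_ [l1 _]]]|s0 s _]; last by exists s0; rewrite mem_head.
  by move: l1; rewrite big_ord0 => /eqP; rewrite eq_sym oner_eq0.
by rewrite dotBr (hv z hz s0) // (hv y hy s0) // subrr.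
Qed.

Hypothesis sp : spanning.

Lemma spanning_neq : exists a b, [/\ a \in S, b \in S & a != b].
Proof.
have n0 : const_mx 1 != 0 :> 'rV[R]_3.
  by apply/eqP => /rowP/(_ 0); rewrite !mxE => /eqP; rewrite oner_eq0.
have [a [b [aS bS h]]] := sp n0; exists a, b; split => //.
by apply: contraNneq h => ->; rewrite subrr dot0r.
Qed.

Lemma spanning_act v : exists x, act S v x.
Proof. by have [a [_ [+ _ _]]] := spanning_neq; apply: act_exists. Qed.

Lemma act_farthest e v : exists x, act S v x /\ forall y, act S v y -> dotv e y <= dotv e x.
Proof.
have [a ha] := spanning_act v.
have [|x] := @seq_max R _ [seq x <- S | act S v x] (dotv e) a.
  by rewrite mem_filter ha (act_mem ha).
rewrite mem_filter => /andP[hx _] hm; exists x; split => // y hy.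
by apply: hm; rewrite mem_filter hy (act_mem hy).
Qed.

Lemma spanning_cross u : u != 0 ->
  exists a b, [/\ a \in S, b \in S & crossv (a - b) u != 0].
Proof.
move=> nu; have [v [nv vu]] := exists_orth nu.
have [a [b [aS bS h]]] := sp nv; exists a, b; split => //.
apply: contraNneq h => h; rewrite (cross_eq0P nu h) dotZr vu mulr0 //.
Qed.

Lemma act_single_neq0 v x : act S v x -> (forall y, act S v y -> y = x) -> v != 0.
Proof.
move=> hx h; apply/eqP => v0.
have z y : y \in S -> y = x.
  by move=> yS; apply: h; apply: act_of_eq hx yS _; rewrite v0 !dot0l.
by have [a [b [aS bS]]] := spanning_neq; rewrite (z a aS) (z b bS) eqxx.
Qed.

Lemma act_parallel_neq0 v u : u != 0 -> act_parallel S v u -> v != 0.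
Proof.
move=> nu h; apply/eqP => v0; have [a [b [aS bS /eqP]]] := spanning_cross nu; apply.
by apply: h; apply/actP; split=> // y _; rewrite v0 !dot0l.
Qed.

End FullDimensional.

(** * Generic projections, aggregated cones and edge directions through active points *)

Section FacesOfPolytope.
Variable R : realType.
Variable S : seq 'rV[R]_3.
Hypothesis sp : spanning S.
Implicit Types (a b c d e n p q u v w x y z : 'rV[R]_3) (r t : R).

Let P := conv S.

Definition diffs : seq 'rV[R]_3 := [seq a - b | a <- S, b <- S].

(* Stronger than not being parallel to a facet; every [w] used below can be so chosen. *)
Definition generic w : Prop :=
  forall d d', d \in diffs -> d' \in diffs ->
    crossv d d' != 0 -> dotv w (crossv d d') != 0.

Lemma diffs_sub a b : a \in S -> b \in S -> a - b \in diffs.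
Proof. by move=> aS bS; apply/allpairsP; exists (a, b). Qed.

Lemma diffs_cross u : u != 0 -> exists2 d, d \in diffs & crossv d u != 0.
Proof.
move=> /(spanning_cross sp)[a [b [aS bS h]]]; exists (a - b) => //; exact: diffs_sub.
Qed.

Lemma generic_parallel w d d' : generic w -> d \in diffs -> d' \in diffs ->
  dotv w (crossv d d') = 0 -> crossv d d' = 0.
Proof.
by move=> gw hd hd' h; apply/eqP/negPn/negP => /(gw d d' hd hd'); rewrite h eqxx.
Qed.

Lemma generic_neq0 w : generic w -> w != 0.
Proof.
move=> gw; apply/eqP => w0.
have [a [b [aS bS ab]]] := spanning_neq sp.
have nab : a - b != 0 by rewrite subr_eq0.
have [d hd hc] := diffs_cross nab.
by case/eqP: hc; apply: (generic_parallel gw) => //; rewrite ?diffs_sub // w0 dot0l.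
Qed.

(** If [x - y] were a non-zero vector parallel to [w], then [w] would be orthogonal to its cross
    product with a difference not parallel to it, against genericity. *)
Lemma generic_inj w x y : generic w -> x \in S -> y \in S -> crossv (x - y) w = 0 -> x = y.
Proof.
move=> gw xS yS h; apply/eqP; rewrite -subr_eq0; apply/eqP; apply: contrapT => /eqP nz.
have [d hd hc] := diffs_cross nz; case/eqP: hc.
apply: (generic_parallel gw) => //; first exact: diffs_sub.
by rewrite triple_rot triple_rot h dot0r.
Qed.

(** A facet has three non-collinear active points, since otherwise it would lie on a line. Its
    normals are then multiples of a cross product of two differences, which genericity keeps from
    being orthogonal to [w]. *)
Lemma generic_facet w (F : set 'rV[R]_3) : generic w -> facet P F -> ~ plane_orth_facet w F.
Proof.
move=> gw [[n FE] [[X [sX [hX fX]]] _]] [m [nm [mF mw]]].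
have {}FE : F = maxface P n by [].
case: X sX hX fX => [|z1 [|z2 []]] //= _ hX /free2P fX.
have [y1 [x1 [Fx1 [Fy1 z1E]]]] := hX z1 (mem_head _ _).
have [y2 [x2 [Fx2 [Fy2 z2E]]]] : exists y x, F y /\ F x /\ z2 = x - y.
  by apply: hX; rewrite !inE eqxx orbT.
have [a ha] := spanning_act sp n.
have actF x : act S n x -> F x by rewrite FE; apply: act_maxface.
have par d : (forall y, act S n y -> crossv (y - a) d = 0) -> forall x, F x -> crossv (x - a) d = 0.
  by move=> hd x; rewrite FE => hx; apply: (maxface_parallel hx ha).
have [b hb nab] : exists2 b, act S n b & b - a != 0.
  apply: contrapT => hn; case/eqP: fX.
  have hy y : act S n y -> y = a.
    move=> hy; apply/eqP; rewrite -subr_eq0; apply/negPn/negP => h; apply: hn.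
    by exists y.
  have hF x : F x -> x = a by rewrite FE => hx; apply: (maxface_single hx).
  by rewrite z1E (hF _ Fx1) (hF _ Fy1) subrr cross0l.
have [c hc nc] : exists2 c, act S n c & crossv (c - a) (b - a) != 0.
  apply: contrapT => hn; case/eqP: fX.
  have hF : forall x, F x -> crossv (x - a) (b - a) = 0.
    apply: par => y hy; apply/eqP/negPn/negP => h; apply: hn; by exists y.
  have hz x y : F x -> F y -> crossv (x - y) (b - a) = 0.
    move=> Fx Fy; have -> : x - y = (x - a) - (y - a) by rewrite opprB addrA subrK.
    by rewrite crossDl crossNl !hF // subr0.
  have z1b : crossv z1 (b - a) = 0 by rewrite z1E hz.
  have z2b : crossv z2 (b - a) = 0 by rewrite z2E hz.
  by rewrite (cross_eq0P nab z1b) (cross_eq0P nab z2b) crossZl crossZr crossvv !scaler0.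
have mc : dotv m (c - a) = 0 by apply: mF; apply: actF.
have mb : dotv m (b - a) = 0 by apply: mF; apply: actF.
have mE := orth2_cross nc mc mb.
have wc : dotv w (crossv (c - a) (b - a)) != 0.
  by apply: gw => //; apply: diffs_sub; [exact: act_mem hc|exact: act_mem ha|exact: act_mem hb|exact: act_mem ha].
move: mw; rewrite mE dotZl => /eqP; rewrite mulf_eq0 (dotC _ w) (negbTE wc) orbF => /eqP h.
by case/eqP: nm; rewrite mE h scale0r.
Qed.

(** By self-adjointness only directions in the plane orthogonal to [w] matter, and by [generic_inj]
    a vertex of the projection comes from a single active point. *)
Lemma proj_vertexP w z : generic w ->
  vertex (proj w @` P)%classic z <->
  exists x v, [/\ dotv v w = 0, act S v x, (forall y, act S v y -> y = x) & z = proj w x].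
Proof.
move=> gw; have nw := generic_neq0 gw; split.
  move=> [u uE]; pose v := proj w u.
  have [x hx] := spanning_act sp v.
  have key y : act S v y -> proj w y = z.
    move=> /act_maxface[Py hy].
    have : [set z]%classic (proj w y).
      rewrite uE; split; first by exists y.
      by move=> _ [y' Py' <-]; rewrite !projE; apply: hy.
    by [].
  exists x, v; split => //; [exact: proj_orth| |by rewrite key].
  move=> y hy; apply: (generic_inj gw); [exact: act_mem hy|exact: act_mem hx|].
  by apply: proj_eq; rewrite !key.
move=> [x [v [vw hx h ->]]]; exists v; apply/seteqP; split => y /=.
  move=> ->; have [Px hm] := act_maxface hx; split; first by exists x.
  by move=> _ [y' Py' <-]; rewrite !projE (proj_id vw); apply: hm.
move=> [[y' Py' <-] hy]; congr (proj w _); apply: maxface_single h; split => // q Pq.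
have := hy (proj w q); rewrite !projE (proj_id vw); apply.
by exists q.
Qed.

Lemma parallel_orth v u n : u != 0 -> nontriv S v -> act_parallel S v u ->
  (forall x, act S v x -> act S n x) -> dotv n u = 0.
Proof.
move=> nu /nontrivP[a [b [ab ha hb]]] par sub.
have h := cross_eq0P nu (par a b ha hb).
have := act_diff0 (sub a ha) (sub b hb); rewrite h dotZr => /eqP.
rewrite mulf_eq0 => /orP[/eqP h0|/eqP //].
by move: h; rewrite h0 scale0r => /eqP; rewrite subr_eq0 (negbTE ab).
Qed.

Lemma maxface_normal_coneP v' v :
  normal_cone P (maxface P v') v <-> forall x, act S v' x -> act S v x.
Proof.
split.
  move=> h x hx; apply/actP; split; first exact: act_mem hx.
  by move=> y yS; apply: h; [apply: conv_mem|apply: act_maxface].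
move=> h x y Px Fy; have [a ha] := spanning_act sp v'.
apply: (@le_trans _ _ (dotv v a)).
  by apply: conv_le Px => s; apply: act_ge; apply: h.
rewrite -lerN2 -dotNl; apply: (maxface_le Fy) => s /h hs.
by rewrite dotNl lerN2 (act_ge hs) // (act_mem ha).
Qed.

(** The active points differ by multiples of [u], so a tilt orthogonal to [u] creates no difference
    among them; [act_perturb] excludes new ones. *)
Lemma act_rotate v u z : act_parallel S v u -> dotv z u = 0 -> u != 0 ->
  ev (fun t => act S (v + t *: z) =1 act S v).
Proof.
move=> par zu nu; apply: ev_mono (act_perturb S v z) => t _ h x.
apply/idP/idP; first exact: h.
move=> hx; have [a ha] := spanning_act sp (v + t *: z).
apply: (act_of_eq ha (act_mem hx)); apply/eqP; rewrite -subr_eq0 -dotBr dotDl.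
rewrite (act_diff0 (h _ ha) hx) dotZl (cross_eq0P nu (par _ _ (h _ ha) hx)).
by rewrite dotZr zu !mulr0 addr0.
Qed.

(** The normal cones entering the aggregated cone of [u] are those of the edges parallel to [u]: two
    independent normals orthogonal to [u] leave the active points only the direction [u]. *)
Lemma agg_coneP u v : u != 0 ->
  agg_cone P u v <->
  exists v', [/\ nontriv S v', act_parallel S v' u & forall x, act S v' x -> act S v x].
Proof.
move=> nu; have uu := dot_gt0 nu; split.
  move=> [F [[v0 FE] [[[X [sX [hX fX]]] _] [Nu Nv]]]].
  have {}FE : F = maxface P v0 by [].
  rewrite {}FE in hX Nu Nv.
  have N0 : dotv u v0 = 0 by apply: Nu; apply/maxface_normal_coneP.
  (* If the face were a single point, its normal cone would contain [v0 + t *: u] for small [t],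
     which is not orthogonal to [u]. *)
  have nt : nontriv S v0.
    apply/negPn/negP => ntn.
    have [t t0 ht] := ev_ex (act_perturb S v0 u).
    have : dotv u (v0 + t *: u) = 0.
      apply: Nu; apply/maxface_normal_coneP => x hx.
      have [a ha] := spanning_act sp (v0 + t *: u).
      by rewrite (trivial_act ntn hx (ht _ ha)).
    by rewrite dotDr N0 dotZr add0r => /eqP; rewrite mulf_eq0 !gt_eqF.
  exists v0; split => //; last exact/maxface_normal_coneP.
  case: X sX hX fX => [|n1 [|n2 []]] //= _ hX /free2P fX a b ha hb.
  have h n : n \in [:: n1; n2] -> dotv n u = 0 /\ dotv n (a - b) = 0.
    move=> /hX hn; rewrite dotC; split; first exact: Nu.
    move/maxface_normal_coneP: hn => hn; apply: act_diff0; exact: hn.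
  have [h1 h1'] := h n1 (mem_head _ _).
  have [h2 h2'] : dotv n2 u = 0 /\ dotv n2 (a - b) = 0 by apply: h; rewrite !inE eqxx orbT.
  rewrite [a - b](orth2_cross fX) 1?dotC // [u](orth2_cross fX) 1?dotC //.
  by rewrite crossZl crossZr crossvv !scaler0.
move=> [v' [nt par sub]].
have nv' := act_parallel_neq0 sp nu par.
have v'u : dotv v' u = 0 by apply: (parallel_orth nu nt par).
exists (maxface P v'); split; first by exists v'.
have Nu : (normal_cone P (maxface P v') `<=` perp u)%classic.
  move=> n /maxface_normal_coneP h; rewrite /perp dotC; exact: (parallel_orth nu nt par).
split; last by split => //; apply/maxface_normal_coneP.
split; last first.
  move=> [X [sX [hX fX]]]; case/eqP: nu; apply: (free3_orth fX sX) => x /hX; exact: Nu.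
(* Rotating [v'] slightly inside the plane orthogonal to [u] gives a second, independent normal of
   the same edge. *)
pose z := crossv u v'.
have zu : dotv z u = 0 by rewrite dotC dot_crossl.
have [t t0 ht] := ev_ex (act_rotate par zu nu).
exists [:: v'; v' + t *: z]; split => //; split.
  move=> x; rewrite !inE => /orP[]/eqP->; apply/maxface_normal_coneP => // y.
  by rewrite ht.
apply/free2P; rewrite crossDr crossvv add0r crossZr /z cross_cross v'u scale0r subr0.
by rewrite !scaler_eq0 !negb_or nu (gt_eqF t0) gt_eqF // dot_gt0.
Qed.

(** Forward, an active difference not parallel to [u] would raise the dimension of the edge to two.
    Backward, the two endpoints are the active points extreme along [u] and [- u]. *)
Lemma edge_directionP u :
  edge_direction P u <->
  [/\ dotv u u = 1, first_nonzero_pos u & exists2 v, nontriv S v & act_parallel S v u].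
Proof.
split.
  move=> [uu [fu [F [[[v FE] [_ hF]] [x [y [_ [_ [Fx [Fy [xy [t yE]]]]]]]]]]]].
  have {}FE : F = maxface P v by [].
  rewrite {}FE in hF Fx Fy.
  split => //; exists v.
    apply/negPn/negP => nt; have [a ha] := spanning_act sp v.
    have h z : maxface P v z -> z = a.
      by move=> hz; apply: (maxface_single hz) => z' hz'; apply: trivial_act nt hz' ha.
    by move: xy; rewrite (h x Fx) (h y Fy) eqxx.
  move=> a b ha hb; apply/eqP/negPn/negP => h; apply: hF.
  exists [:: a - b; y - x]; split => //; split.
    move=> z; rewrite !inE => /orP[]/eqP->; [exists b, a|exists x, y]; split => //.
      exact: act_maxface.
    by split => //; apply: act_maxface.
  apply/free2P; rewrite yE crossZr scaler_eq0 negb_or h andbT.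
  by apply: contraNneq xy => t0; move/eqP: yE; rewrite t0 scale0r subr_eq0 eq_sym.
move=> [uu fu [v nt par]].
have nu := unit_neq0 uu.
(* Tilting [v] towards [d] isolates the active point farthest along [d], which is therefore a
   vertex; [d] will be [u] and then [- u]. *)
have extreme d : d != 0 -> crossv d u = 0 ->
    exists x, [/\ act S v x, vertex P x & forall y, act S v y -> dotv d y <= dotv d x].
  move=> nd du; have [x [hx hm]] := act_farthest sp d v.
  exists x; split => //.
  have [t t0 ht] := ev_ex (act_perturb S v d).
  have single y : act S (v + t *: d) y -> y = x.
    move=> hy; have hy' := ht _ hy.
    have := act_ge hy (act_mem hx); rewrite !dotDl !dotZl (act_eq hy' hx) lerD2l ler_pM2l //.
    move=> hle; have dxy : dotv d (y - x) = 0.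
      by rewrite dotBr; apply/eqP; rewrite subr_eq0 eq_le hle hm.
    have yxd : crossv (y - x) d = 0.
      rewrite (cross_eq0P nu (par _ _ hy' hx)) (cross_eq0P nu du).
      by rewrite crossZl crossZr crossvv !scaler0.
    apply/eqP; rewrite -subr_eq0 (cross_eq0P nd yxd) (dotC _ d) dxy mul0r scale0r //.
  have [a' ha'] := spanning_act sp (v + t *: d).
  by apply: (act_vertex (v := v + t *: d)) => //; rewrite -(single _ ha').
have [x [hx vx mx]] := extreme u nu (crossvv u).
have [y [hy vy my]] : exists x, [/\ act S v x, vertex P x & forall y, act S v y -> dotv (- u) y <= dotv (- u) x].
  by apply: extreme; rewrite ?oppr_eq0 // crossNl crossvv oppr0.
have xy : x != y.
  apply/eqP => xy; case/nontrivP: nt => a [b [/eqP ab ha hb]]; apply: ab.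
  have E c : act S v c -> dotv u c = dotv u x.
    move=> hc; apply/eqP; rewrite eq_le mx //=.
    by have := my c hc; rewrite !dotNl lerN2 xy.
  apply/eqP; rewrite -subr_eq0 (cross_eq0P nu (par _ _ ha hb)) dotC dotBr (E a) // (E b) //.
  by rewrite subrr mul0r scale0r.
split => //; split => //; exists (maxface P v).
have hF z : maxface P v z -> crossv (z - x) u = 0.
  by move=> hz; apply: (maxface_parallel hz hx) => c hc; apply: par.
have hFF z z' : maxface P v z -> maxface P v z' -> crossv (z - z') u = 0.
  move=> hz hz'; have -> : z - z' = (z - x) - (z' - x) by rewrite opprB addrA subrK.
  by rewrite crossDl crossNl !hF // subr0.
split.
  split; first by exists v.
  split.
    exists [:: y - x]; split => //; split.
      move=> z; rewrite inE => /eqP->; exists x, y; split; first exact: act_maxface.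
      by split => //; apply: act_maxface.
    by rewrite free_cons span_nil memv0 subr_eq0 eq_sym xy nil_free.
  move=> [X [sX [hX fX]]]; case: X sX hX fX => [|z1 [|z2 []]] //= _ hX /free2P/eqP; apply.
  have h z : z \in [:: z1; z2] -> crossv z u = 0.
    by move=> /hX[z' [z'' [h1 [h2 ->]]]]; apply: hFF.
  rewrite (cross_eq0P nu (h z1 _)) ?mem_head // (cross_eq0P nu (h z2 _)) ?inE ?eqxx ?orbT //.
  by rewrite crossZl crossZr crossvv !scaler0.
exists x, y; do 2 (split => //); split; first exact: act_maxface.
split; first exact: act_maxface.
split => //; exists (dotv (y - x) u / dotv u u); exact: (cross_eq0P nu (par _ _ hy hx)).
Qed.

End FacesOfPolytope.

(** * Counting the vertices of a generic projection by its edges *)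

Section CountingProjectionVertices.
Variable R : realType.
Variable S : seq 'rV[R]_3.
Hypothesis sp : spanning S.
Implicit Types (a b c d e n p q u v w x y z : 'rV[R]_3) (r t : R).

Let P := conv S.

(** Zero is included, because [diffs S] contains [a - a]; statements needing a non-zero direction
    assume it separately. *)
Definition is_dir e : Prop := exists2 d, d \in diffs S & exists2 r, r != 0 & e = r *: d.

Lemma diffs_dir d : d \in diffs S -> is_dir d.
Proof. by move=> h; exists d => //; exists 1; rewrite ?oner_eq0 ?scale1r. Qed.

Lemma is_dirN e : is_dir e -> is_dir (- e).
Proof.
move=> [d hd [r nr ->]]; exists d => //; exists (- r); first by rewrite oppr_eq0.
by rewrite scaleNr.
Qed.

Lemma edge_direction_dir u : edge_direction P u -> is_dir u.
Proof.
move/(edge_directionP sp) => [uu _ [v /nontrivP[a [b [ab ha hb]]] par]].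
have nu := unit_neq0 uu.
have h := cross_eq0P nu (par a b ha hb); rewrite uu divr1 in h.
have nr : dotv (a - b) u != 0.
  by apply: contraNneq ab => r0; move/eqP: h; rewrite r0 scale0r subr_eq0.
exists (a - b); first by apply: diffs_sub; [exact: act_mem ha|exact: act_mem hb].
exists (dotv (a - b) u)^-1; first by rewrite invr_eq0.
by rewrite {2}h scalerA mulVf // scale1r.
Qed.

Lemma generic_dir w e e' : generic S w -> is_dir e -> is_dir e' ->
  dotv w (crossv e e') = 0 -> crossv e e' = 0.
Proof.
move=> gw [d hd [r nr ->]] [d' hd' [r' nr' ->]]; rewrite crossZl crossZr !dotZr => /eqP.
rewrite !mulf_eq0 (negbTE nr) (negbTE nr') => /eqP h.
by rewrite (generic_parallel gw hd hd' h) !scaler0.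
Qed.

(** A difference orthogonal to [crossv e w] has a cross product with [e] orthogonal to [w], so
    genericity makes it parallel to [e]. *)
Lemma generic_act_parallel w e : generic S w -> is_dir e ->
  act_parallel S (crossv e w) e.
Proof.
move=> gw he a b ha hb; apply: (generic_dir gw) => //.
  by apply: diffs_dir; apply: diffs_sub; [exact: act_mem ha|exact: act_mem hb].
by rewrite -triple_rot dotC (act_diff0 ha hb).
Qed.

Lemma generic_cross_neq0 w e : generic S w -> is_dir e -> e != 0 -> crossv e w != 0.
Proof.
move=> gw he ne; have [d hd hc] := diffs_cross sp ne.
apply: contraNneq hc => h; apply/eqP/(generic_dir gw) => //; first exact: diffs_dir.
by rewrite -triple_rot h dot0r.
Qed.

(** This is the function g of the overview: at [crossv u w] it counts the edges of the projected
    polygon parallel to the projection of [u]. *)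
Definition edge_count v : nat := (nontriv S v + nontriv S (- v))%N.

(* Seen along [w], [x] is the last vertex of the edge with outer normal [e x w]. *)
Definition edge_end w e x : Prop :=
  act S (crossv e w) x /\ forall y, act S (crossv e w) y -> dotv e y <= dotv e x.

Lemma edge_end_uniq w e x y : generic S w -> is_dir e -> e != 0 ->
  edge_end w e x -> edge_end w e y -> x = y.
Proof.
move=> gw he ne [hx mx] [hy my].
have h := cross_eq0P ne (generic_act_parallel gw he hx hy).
apply/eqP; rewrite -subr_eq0 h dotBl (dotC x) (dotC y).
have -> : dotv e x = dotv e y by apply/eqP; rewrite eq_le mx // my.
by rewrite subrr mul0r scale0r.
Qed.

Lemma edge_end_start w e x : generic S w -> is_dir e -> e != 0 ->
  nontriv S (crossv e w) -> edge_end w e x ->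
  exists2 y, act S (crossv e w) y & exists2 t, 0 < t & x - y = t *: e.
Proof.
move=> gw he ne /nontrivP[a [b [ab ha hb]]] [hx mx].
have [y hy xy] : exists2 y, act S (crossv e w) y & x != y.
  have [<-|xa] := eqVneq a x; first by exists b.
  by exists a => //; rewrite eq_sym.
exists y => //; have h := cross_eq0P ne (generic_act_parallel gw he hx hy).
exists (dotv (x - y) e / dotv e e) => //.
rewrite divr_gt0 ?dot_gt0 // lt_def dotC dotBr subr_ge0 mx // andbT.
apply: contraNneq xy => h0; rewrite -subr_eq0 h dotC dotBr h0 mul0r scale0r //.
Qed.

(** Tilting the edge normal [m] by [crossv w m] stays orthogonal to [w] and has positive product
    with [e], which isolates the last point of the edge. *)
Lemma edge_end_vertex w e x : generic S w -> is_dir e -> e != 0 -> edge_end w e x ->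
  exists v, [/\ dotv v w = 0, act S v x & forall y, act S v y -> y = x].
Proof.
move=> gw he ne [hx mx]; set m := crossv e w in hx mx.
pose z := crossv w m.
have [t t0 ht] := ev_ex (act_perturb S m z).
have mw : dotv m w = 0 by rewrite dotC dot_crossr.
have ze : 0 < dotv z e.
  rewrite /z (_ : dotv _ e = dotv m m); first exact/dot_gt0/generic_cross_neq0.
  by rewrite dotC triple_rot.
exists (m + t *: z).
have single y : act S (m + t *: z) y -> y = x.
  move=> hy; have hy' := ht _ hy.
  have h := cross_eq0P ne (generic_act_parallel gw he hx hy').
  have := act_ge hy (act_mem hx); rewrite !dotDl !dotZl (act_eq hy' hx) lerD2l ler_pM2l //.
  rewrite -subr_le0 -dotBr h dotZr pmulr_lle0 // => hle.
  have hge : 0 <= dotv (x - y) e / dotv e e.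
    by rewrite divr_ge0 ?dot_ge0 // dotC dotBr subr_ge0 mx.
  apply/esym/eqP; rewrite -subr_eq0 h.
  have -> : dotv (x - y) e / dotv e e = 0 by apply/eqP; rewrite eq_le hle hge.
  by rewrite scale0r.
have [a ha] := spanning_act sp (m + t *: z).
split => //; last by rewrite -(single _ ha).
by rewrite dotDl dotZl mw (dotC z) dot_crossl mulr0 addr0.
Qed.

(* Rotate the supporting line at [x] until it meets another point: the point [y]
   maximizing the slope is the other end of the edge. *)
Lemma vertex_edge_end w v x : generic S w -> dotv v w = 0 -> act S v x ->
  (forall y, act S v y -> y = x) ->
  exists u, edge_direction P u /\ exists2 e, e = u \/ e = - u &
    nontriv S (crossv e w) /\ edge_end w e x.
Proof.
move=> gw vw hx hv; have nv := act_single_neq0 sp hx hv.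
have nw := generic_neq0 sp gw; have ww := dot_gt0 nw.
have pos y : y \in S -> y != x -> 0 < dotv v (x - y).
  move=> yS yx; rewrite dotBr subr_gt0; apply: (act_lt hx yS).
  by apply: contra_neqN yx => /hv.
pose m := crossv v w.
have mw : dotv m w = 0 by rewrite dotC dot_crossr.
pose slope y := - (dotv m (x - y) / dotv v (x - y)).
have [y0 y0S y0x] : exists2 y, y \in S & y != x.
  have [a [b [aS bS h]]] := sp nv.
  have [ax|ax] := eqVneq a x; last by exists a.
  exists b => //; apply: contraNneq h => ->; by rewrite ax subrr dot0r.
have [|y] := @seq_max R _ [seq y <- S | y != x] slope y0.
  by rewrite mem_filter y0x.
rewrite mem_filter => /andP[yx yS] my.
have py := pos y yS yx.
(* Maximal [slope] makes [g] the least ratio, so [p] is non-negative on every [x - z] and zero on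
   [x - y]: both [x] and [y] are active for [p]. *)
pose g := dotv m (x - y) / dotv v (x - y); pose p := m - g *: v.
have pw : dotv p w = 0 by rewrite dotBl dotZl mw vw mulr0 subrr.
have pxy : dotv p (x - y) = 0.
  by rewrite dotBl dotZl /g divfK ?subrr // gt_eqF.
have px : act S p x.
  apply/actP; split; first exact: act_mem hx.
  move=> z zS; rewrite -subr_ge0 -dotBr dotBl dotZl.
  have [->|zx] := eqVneq z x; first by rewrite subrr !dot0r mulr0 subrr.
  have pz := pos z zS zx.
  have := my z; rewrite mem_filter zx zS => /(_ isT); rewrite lerN2 -/g.
  by rewrite ler_pdivlMr // subr_ge0.
have py' : act S p y by apply: act_of_eq px yS _; apply/eqP; rewrite -subr_eq0 -dotBr pxy.
have nd : x - y != 0 by rewrite subr_eq0 eq_sym.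
have [r [u [nr uE uu fu]]] := normalize_dir nd.
(* The unit vector pointing from [y] to [x], so that [x] is the last point of the edge rather than
   the first. *)
pose e := `|r| *: (x - y).
have r0 : 0 < `|r| by rewrite normr_gt0.
have eu : e = u \/ e = - u.
  rewrite /e uE; case: (ltgtP r 0) => [rn|rp|r00]; last by rewrite r00 eqxx in nr.
    by right; rewrite ltr0_norm // scaleNr.
  by left; rewrite gtr0_norm.
have ne : e != 0 by rewrite scaler_eq0 negb_or gt_eqF.
have he : is_dir e.
  by exists (x - y); [apply: diffs_sub; [exact: act_mem hx|]|exists `|r|; rewrite ?normr_eq0].
have ve : 0 < dotv v e by rewrite dotZr mulr_gt0.
have ncr : crossv e w != 0 by apply: generic_cross_neq0.
have pe : dotv p e = 0 by rewrite dotZr pxy mulr0.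
have pE := orth2_cross ncr pe pw.
have wp : crossv w p = dotv w w *: v + g *: m.
  rewrite /p crossDr crossNr crossZr /m cross_cross (dotC w v) vw scale0r subr0.
  by rewrite (crossC w v) scalerN opprK.
(* The numerator equals [(dotv w w + g * g) * dotv v e]; positivity gives [p] the same active points
   as [crossv e w]. *)
have lpos : 0 < dotv p (crossv e w) / dotv (crossv e w) (crossv e w).
  rewrite divr_gt0 ?dot_gt0 // -triple_rot wp dotDr !dotZr.
  have me : dotv m e = g * dotv v e.
    by move: pe; rewrite dotBl dotZl => /eqP; rewrite subr_eq0 => /eqP.
  rewrite (dotC e v) (dotC e m) me mulrA -mulrDl mulr_gt0 // ltr_pwDl //.
  by rewrite -expr2 sqr_ge0.
have actE : act S p =1 act S (crossv e w) by rewrite [in act S p]pE; apply: act_scale.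
have nt : nontriv S (crossv e w).
  by apply/nontrivP; exists x, y; rewrite -!actE px py' -subr_eq0 nd.
have par := generic_act_parallel gw he.
exists u; split; last exists e => //.
  apply/(edge_directionP sp); split => //; exists (crossv e w) => // a b ha hb.
  by have := par a b ha hb; case: eu => -> //; rewrite crossNr => /eqP; rewrite oppr_eq0 => /eqP.
split => //; split; first by rewrite -actE.
move=> z hz; rewrite -subr_ge0 -dotBr.
have hz' : act S (crossv e w) x by rewrite -actE.
have h := cross_eq0P ne (par _ _ hz' hz).
have := act_diff_ge0 hx (act_mem hz); rewrite h dotZr pmulr_lge0 // dotZr => h0.
by rewrite mulr_ge0 // ltW // dot_gt0.
Qed.

(** Since both edges end at [x], comparison with their other points bounds the triple product of
    [w], [e'], [e] from both sides by zero, so the directions are parallel. If they were opposite,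
    [crossv e w] would be constant on [S]. *)
Lemma edge_end_inj w e e' x : generic S w -> is_dir e -> is_dir e' ->
  dotv e e = 1 -> dotv e' e' = 1 ->
  nontriv S (crossv e w) -> nontriv S (crossv e' w) ->
  edge_end w e x -> edge_end w e' x -> e = e'.
Proof.
move=> gw he he' ee ee' nt nt' hx hx'.
have ne := unit_neq0 ee.
have ne' := unit_neq0 ee'.
have [y hy [t t0 xy]] := edge_end_start gw he ne nt hx.
have [y' hy' [t' t0' xy']] := edge_end_start gw he' ne' nt' hx'.
have h1 := act_diff_ge0 hx.1 (act_mem hy').
have h2 := act_diff_ge0 hx'.1 (act_mem hy).
rewrite xy' dotZr pmulr_rge0 // dotC triple_rot in h1.
rewrite xy dotZr pmulr_rge0 // dotC triple_rot crossC dotNr oppr_ge0 in h2.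
have h0 : dotv w (crossv e' e) = 0 by apply/eqP; rewrite eq_le h1 h2.
have := generic_dir gw he' he h0.
case/(parallel_unit ee' ee) => // eN; exfalso.
have nc := generic_cross_neq0 gw he ne.
have [a [b [aS bS /eqP]]] := sp nc; apply.
have const z : z \in S -> dotv (crossv e w) z = dotv (crossv e w) x.
  move=> zS; apply/eqP; rewrite eq_le (act_ge hx.1) //=.
  by have := act_ge hx'.1 zS; rewrite eN crossNl !dotNl lerN2.
by rewrite dotBr !const // subrr.
Qed.

Lemma sum_nat_of_bool (T : Type) (s : seq T) (f : pred T) : (\sum_(x <- s) f x)%N = count f s.
Proof. by rewrite -sum1_count [RHS]big_mkcond; apply: eq_bigr => x _; case: (f x). Qed.

(** Going around the polygon, each vertex is the end of exactly one oriented edge; this bijection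
    replaces the cyclic order. *)
Lemma proj_vertex_count (s : seq 'rV[R]_3) w k : uniq s ->
  (forall u, edge_direction P u <-> u \in s) -> generic S w ->
  has_card (vertex (proj w @` P)%classic) k ->
  k = (\sum_(u <- s) edge_count (crossv u w))%N.
Proof.
move=> us hs gw [T [uT [sT hT]]].
(* Both orientations are listed, because an edge parallel to [u] has outer normal along [crossv u w]
   or its opposite. *)
pose s2 := s ++ map -%R s.
have s2P e : e \in s2 -> [/\ is_dir e, e != 0 & dotv e e = 1].
  have h u : u \in s -> [/\ is_dir u, u != 0 & dotv u u = 1].
    move=> /hs hu; have [uu _ _] := (edge_directionP sp u).1 hu.
    by split => //; [exact: edge_direction_dir|exact: unit_neq0].
  rewrite mem_cat => /orP[/h //|/mapP[u /h[h1 h2 h3] ->]].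
  by split; [exact: is_dirN|rewrite oppr_eq0|rewrite dotNl dotNr opprK].
have us2 : uniq s2.
  rewrite cat_uniq us map_inj_uniq ?us ?andbT //=; last exact: oppr_inj.
  apply/hasPn => _ /mapP[u us' ->]; apply/negP => /hs hN.
  move/hs: us' => /(edge_directionP sp)[_ f _].
  move/(edge_directionP sp): hN => [_ f' _].
  exact: (first_nonzero_pos_opp f f').
pose L := [seq e <- s2 | nontriv S (crossv e w)].
have [phi hphi] := boolp.choice (fun e => act_farthest sp e (crossv e w)).
have {}hphi e : edge_end w e (phi e) by apply: hphi.
have phiS e : phi e \in S by apply: act_mem (hphi e).1.
have LE : k = size L.
  rewrite -sT -(size_map (fun e => proj w (phi e)) L); apply/perm_size/uniq_perm => //.
    rewrite map_inj_in_uniq ?filter_uniq // => e e'.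
    rewrite !mem_filter => /andP[nt /s2P[he ne ee]] /andP[nt' /s2P[he' ne' ee']] h.
    have xE : phi e = phi e' by apply: (generic_inj sp gw) => //; apply: proj_eq.
    by apply: (edge_end_inj (x := phi e) gw) => //; rewrite xE.
  move=> z; apply/idP/idP.
    move=> /hT /(proj_vertexP sp _ gw)[x [v [vw hx hv ->]]].
    have [u [hu [e eu [nt ex]]]] := vertex_edge_end gw vw hx hv.
    have es : e \in s2.
      rewrite mem_cat; apply/orP; case: eu => ->; first by left; apply/hs.
      by right; apply: map_f; apply/hs.
    have [he ne ee] := s2P e es.
    apply/mapP; exists e; first by rewrite mem_filter nt.
    by rewrite (edge_end_uniq gw he ne ex (hphi e)).
  move=> /mapP[e]; rewrite mem_filter => /andP[nt /s2P[he ne ee]] ->.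
  apply/hT/(proj_vertexP sp _ gw).
  have [v [h1 h2 h3]] := edge_end_vertex gw he ne (hphi e).
  by exists (phi e), v.
rewrite LE size_filter count_cat count_map /edge_count big_split /= !sum_nat_of_bool.
by congr addn; apply: eq_count => u /=; rewrite crossNl.
Qed.

End CountingProjectionVertices.

(** * One-sided limits of the edge count *)

Section Germs.
Variable R : realType.
Variable S : seq 'rV[R]_3.
Implicit Types (a b c d e n p q u v w x y z : 'rV[R]_3) (r t : R).

(** Active points depend only on how the functional orders [S]. *)
Lemma edge_count_cmp v v' :
  (forall a b, a \in S -> b \in S -> (dotv v b <= dotv v a) = (dotv v' b <= dotv v' a)) ->
  edge_count S v = edge_count S v'.
Proof.
move=> h; rewrite /edge_count; congr (nat_of_bool _ + nat_of_bool _)%N.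
  by apply: nontriv_eq; apply: act_cmp.
apply: nontriv_eq; apply: act_cmp => a b aS bS.
by rewrite !dotNl !lerN2 h.
Qed.

Lemma edge_count_scale r v : 0 < r -> edge_count S (r *: v) = edge_count S v.
Proof. by move=> r0; apply: edge_count_cmp => a b _ _; rewrite !dotZl ler_pM2l. Qed.

Lemma edge_countN v : edge_count S (- v) = edge_count S v.
Proof. by rewrite /edge_count opprK addnC. Qed.

Lemma edge_count_scale_neq0 r v : r != 0 -> edge_count S (r *: v) = edge_count S v.
Proof.
case: (ltgtP r 0) => // r0 _; last exact: edge_count_scale.
by rewrite -edge_countN -scaleNr edge_count_scale // oppr_gt0.
Qed.

(** For small [t] the order on [S] is lexicographic, first by [n] and then by [y], and so no longer
    depends on [t]. *)
Lemma ev_cmp_lex n y : ev (fun t => forall a, a \in S -> forall b, b \in S ->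
  (dotv (n + t *: y) b <= dotv (n + t *: y) a) =
  (0 < dotv n (a - b)) || (dotv n (a - b) == 0) && (0 <= dotv y (a - b))).
Proof.
apply: ev_seq => a _; apply: ev_seq => b _.
have E t : (dotv (n + t *: y) b <= dotv (n + t *: y) a) =
           (0 <= dotv n (a - b) + t * dotv y (a - b)).
  by rewrite -subr_ge0 -dotBr dotDl dotZl.
case: (ltgtP 0 (dotv n (a - b))) => h /=.
- by apply: ev_mono (ev_lin_gt0 (dotv y (a - b)) h) => t _ /ltW; rewrite E.
- by apply: ev_mono (ev_lin_lt0 (dotv y (a - b)) h) => t _; rewrite E ltNge => /negbTE.
- by apply: ev_all => t t0; rewrite E -h add0r pmulr_rge0.
Qed.

Lemma germ_exists n y : exists k, ev (fun t => edge_count S (n + t *: y) = k).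
Proof.
have h := ev_cmp_lex n y; have [t0 _ ht0] := ev_ex h.
exists (edge_count S (n + t0 *: y)); apply: ev_mono h => t _ ht.
by apply: edge_count_cmp => a b aS bS; rewrite ht // ht0.
Qed.

(** The limit of [edge_count S] at [n] when approached from the side of [y]. *)
Definition germ n y : nat := sval (cid (germ_exists n y)).

Lemma germP n y : ev (fun t => edge_count S (n + t *: y) = germ n y).
Proof. exact: svalP (cid (germ_exists n y)). Qed.

Lemma germ_uniq n y k : ev (fun t => edge_count S (n + t *: y) = k) -> germ n y = k.
Proof. by move/(evI (germP n y))/ev_ex => [t _ [<- <-]]. Qed.

Lemma germ_scale r n y : 0 < r -> germ (r *: n) y = germ n y.
Proof.
move=> r0; apply: germ_uniq.
have ri : 0 < r^-1 by rewrite invr_gt0.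
apply: ev_mono (ev_scale ri (germP n y)) => t _ <-.
by rewrite -[RHS](edge_count_scale _ r0) scalerDr scalerA mulrA divff ?gt_eqF // mul1r.
Qed.

Lemma germN n y : germ (- n) (- y) = germ n y.
Proof.
apply: germ_uniq; apply: ev_mono (germP n y) => t _ <-.
by rewrite -edge_countN opprD opprK scalerN opprK.
Qed.

(** A tilt that breaks no tie of [n] leaves the order on [S] unchanged. *)
Lemma germ_stable n y : (forall d, d \in diffs S -> dotv n d = 0 -> dotv y d = 0) ->
  germ n y = edge_count S n.
Proof.
move=> h; apply: germ_uniq; apply: ev_mono (ev_cmp_lex n y) => t _ ht.
apply: edge_count_cmp => a b aS bS; rewrite ht // -[in RHS]subr_ge0 -dotBr.
rewrite [RHS]le_eqVlt [RHS]orbC [0 == _]eq_sym.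
by case: eqP => //= h0; rewrite h ?lexx ?diffs_sub.
Qed.

Lemma germ_same_side r r' n y : 0 < r * r' -> germ (r *: n) y = germ (r' *: n) y.
Proof.
move=> rr.
have nr' : r' != 0 by apply: contraTneq rr => ->; rewrite mulr0 ltxx.
have -> : r *: n = (r / r') *: (r' *: n) by rewrite scalerA divfK.
rewrite germ_scale //; have -> : r / r' = (r * r') / (r' ^+ 2) by field.
by rewrite divr_gt0 // exprn_even_gt0.
Qed.

End Germs.

(** * Equiprojectivity makes the edge count constant at regular normals *)

Section ConstancyOfEdgeCount.
Variable R : realType.
Variable S : seq 'rV[R]_3.
Hypothesis sp : spanning S.
Variable s : seq 'rV[R]_3.
Hypothesis us : uniq s.
Hypothesis hs : forall u, edge_direction (conv S) u <-> u \in s.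
Variable k : nat.
Hypothesis hk : k_equiprojective (conv S) k.
Implicit Types (a b c d e n p q u v w x y z : 'rV[R]_3) (r t : R).

Lemma generic_sum w : generic S w -> (\sum_(u <- s) edge_count S (crossv u w))%N = k.
Proof.
move=> gw; apply/esym/(proj_vertex_count sp us hs gw)/(hk (generic_neq0 sp gw)) => F.
exact: generic_facet.
Qed.

(** The base point [w] need not be generic: linearity of the cross product carries the constant sum
    at nearby generic directions to the germs. *)
Lemma germ_sum w y : ev (fun t => generic S (w + t *: y)) ->
  (\sum_(u <- s) germ S (crossv u w) (crossv u y))%N = k.
Proof.
move=> gw.
have h := ev_seq (s := s) (fun u _ => germP S (crossv u w) (crossv u y)).
have [t _ [gt ht]] := ev_ex (evI gw h).
rewrite -(generic_sum gt); apply: eq_big_seq => u hu.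
by rewrite -ht // crossDr crossZr.
Qed.

Lemma direction_unit u : u \in s -> dotv u u = 1.
Proof. by move/hs/(edge_directionP sp) => []. Qed.

Lemma direction_neq0 u : u \in s -> u != 0.
Proof. by move=> /direction_unit/unit_neq0. Qed.

Lemma direction_parallel u u' : u \in s -> u' \in s -> crossv u u' = 0 -> u = u'.
Proof.
move=> hu hu' /(parallel_unit (direction_unit hu) (direction_unit hu'))[] // uE.
move/hs/(edge_directionP sp): hu => [_ + _]; rewrite uE => f.
move/hs/(edge_directionP sp): hu' => [_ f' _].
by case: (first_nonzero_pos_opp f' f).
Qed.

Lemma sum_swap (T : eqType) (l : seq T) (i0 : T) (f1 f2 f3 f4 : T -> nat) m :
  uniq l -> i0 \in l ->
  (\sum_(i <- l) f1 i)%N = m -> (\sum_(i <- l) f2 i)%N = m ->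
  (\sum_(i <- l) f3 i)%N = m -> (\sum_(i <- l) f4 i)%N = m ->
  (forall i, i \in l -> i != i0 -> (f1 i + f2 i = f3 i + f4 i)%N) ->
  (f1 i0 + f2 i0 = f3 i0 + f4 i0)%N.
Proof.
move=> ul xl h1 h2 h3 h4 h.
have : (\sum_(i <- l) (f1 i + f2 i) = \sum_(i <- l) (f3 i + f4 i))%N.
  by rewrite !big_split /= h1 h2 h3 h4.
rewrite !(bigD1_seq i0) //=.
have -> : (\sum_(i <- l | i != i0) (f1 i + f2 i) = \sum_(i <- l | i != i0) (f3 i + f4 i))%N.
  by rewrite big_seq_cond [RHS]big_seq_cond; apply: eq_bigr => i /andP[hx]; apply: h.
exact: addIn.
Qed.

(* Compare the four projections along [u0 +- r (n x u0) +- t (d x u0)] for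
   [t << r << 1]. Passing [n^perp] near [u0] on either side of the line of [u0]
   has the same effect on the edges parallel to any other direction, but opposite
   effects on those parallel to [u0]. *)
Lemma germ_sym u0 n d : u0 \in s -> dotv n u0 = 0 -> dotv d u0 = 0 -> crossv n d != 0 ->
  germ S n d = germ S n (- d).
Proof.
move=> u0s nu du nd; have uu := direction_unit u0s; have nu0 := direction_neq0 u0s.
have nn : n != 0 by apply: contraNneq nd => ->; rewrite cross0l.
(* Quarter turns about [u0], chosen so that [crossv u0 z] is [n] and [crossv u0 y] is [d]. *)
pose z := crossv n u0; pose y := crossv d u0.
have uz : crossv u0 z = n by rewrite cross_cross uu (dotC u0 n) nu scale1r scale0r subr0.
have uy : crossv u0 y = d by rewrite cross_cross uu (dotC u0 d) du scale1r scale0r subr0.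
have yn : dotv y n != 0.
  rewrite dotC triple_rot; apply: contraNneq nu0 => h.
  rewrite dotC in nu; rewrite dotC in du.
  by rewrite (orth2_cross nd nu du) h mul0r scale0r.
pose W r := u0 + r *: z.
(* Both base points lie in the plane orthogonal to [n]. A small [r] avoids all critical planes not
   orthogonal to [n], and for each other direction orthogonal to [n] it puts the two cross products
   on the same side of the line of [n]. *)
have [r r0 [hW hsign]] : exists2 r, 0 < r &
    (forall d1, d1 \in diffs S -> forall d2, d2 \in diffs S ->
       crossv (crossv d1 d2) n != 0 ->
       dotv (crossv d1 d2) (W r) != 0 /\ dotv (crossv d1 d2) (W (- r)) != 0) /\
    (forall u, u \in s -> u != u0 -> dotv u n = 0 ->
       exists r1 r2, [/\ crossv u (W r) = r1 *: n, crossv u (W (- r)) = r2 *: n & 0 < r1 * r2]).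
  apply: ev_ex; apply: evI.
    apply: ev_seq => d1 _; apply: ev_seq => d2 _.
    have [_|nc] := eqVneq (crossv (crossv d1 d2) n) 0; first exact: ev_all.
    set c := crossv d1 d2 in nc *.
    have h0 : dotv c u0 = 0 -> dotv c z != 0.
      move=> cu; apply: contraNneq nc => cz.
      by rewrite -uz cross_cross cu cz !scale0r subrr.
    have h0' : dotv c u0 = 0 -> - dotv c z != 0 by rewrite oppr_eq0.
    apply: ev_mono (evI (ev_lin_neq0 h0) (ev_lin_neq0 h0')) => t _ [h1 h2] _.
    by rewrite /W !dotDr !dotZr mulNr -mulrN.
  apply: ev_seq => u hu.
  have [_|uu0] := eqVneq u u0; first exact: ev_all.
  have [un|un] := eqVneq (dotv u n) 0; last by apply: ev_all => t _ _ h; rewrite h eqxx in un.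
  have cn : crossv (crossv u u0) n = 0.
    by rewrite crossC cross_cross (dotC n u) un nu !scale0r subrr oppr0.
  pose c := dotv (crossv u u0) n / dotv n n.
  have cE : crossv u u0 = c *: n := cross_eq0P nn cn.
  have nc : c != 0.
    apply: contraNneq uu0 => c0; apply/eqP/(direction_parallel hu u0s).
    by rewrite cE c0 scale0r.
  have c2 : 0 < c * c by rewrite -expr2 exprn_even_gt0.
  have WE t : crossv u (W t) = (c + t * dotv u u0) *: n.
    by rewrite /W crossDr crossZr cE /z cross_cross un scale0r subr0 scalerA -scalerDl.
  have e1 := ev_lin_gt0 (c * dotv u u0) c2; have e2 := ev_lin_gt0 (- (c * dotv u u0)) c2.
  apply: ev_mono (evI e1 e2) => t _ [h1 h2] _ _.
  exists (c + t * dotv u u0), (c - t * dotv u u0); split => //; first by rewrite WE mulNr.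
  have h12 := mulr_gt0 h1 h2.
  rewrite -(pmulr_rgt0 _ c2); apply: lt_le_trans h12 _; rewrite le_eqVlt; apply/orP; left.
  by apply/eqP; ring.
(* The only critical plane through the base point is the one orthogonal to [n], and moving along [y]
   or [- y] leaves it. *)
have genW r' y' : (r' = r \/ r' = - r) -> (y' = y \/ y' = - y) ->
    ev (fun t => generic S (W r' + t *: y')).
  move=> hr' hy'.
  have y'n : dotv y' n != 0 by case: hy' => ->; rewrite ?dotNl ?oppr_eq0.
  have : ev (fun t => forall d1, d1 \in diffs S -> forall d2, d2 \in diffs S ->
      crossv d1 d2 != 0 -> dotv (W r' + t *: y') (crossv d1 d2) != 0).
    apply: ev_seq => d1 h1; apply: ev_seq => d2 h2.
    have [_|nc] := eqVneq (crossv d1 d2) 0; first exact: ev_all.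
    have h0 : dotv (W r') (crossv d1 d2) = 0 -> dotv y' (crossv d1 d2) != 0.
      move=> w0; have cn : crossv (crossv d1 d2) n = 0.
        apply/eqP/negPn/negP => /(hW d1 h1 d2 h2)[].
        by rewrite ![dotv (crossv _ _) _]dotC; case: hr' w0 => -> ->; rewrite eqxx.
      have cE := cross_eq0P nn cn; rewrite cE dotZr mulf_neq0 //.
      by apply: contraNneq nc => c0; rewrite cE c0 scale0r.
    by apply: ev_mono (ev_lin_neq0 h0) => t _ h _; rewrite dotDl dotZl.
  by apply: ev_mono => t _ h d1 d2 h1 h2; apply: h.
pose f r' y' u := germ S (crossv u (W r')) (crossv u y').
have sum r' y' (hr' : r' = r \/ r' = - r) (hy' : y' = y \/ y' = - y) :
  (\sum_(u <- s) f r' y' u)%N = k := germ_sum (genW r' y' hr' hy').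
(* A direction not orthogonal to [n] has no critical tie at the base point: tied points differ by
   multiples of [u], so both germs equal the count there. *)
have stable r' u : u \in s -> (r' = r \/ r' = - r) -> dotv u n != 0 -> f r' y u = f r' (- y) u.
  move=> hu hr' un.
  have par d1 : d1 \in diffs S -> dotv (crossv u (W r')) d1 = 0 -> crossv d1 u = 0.
    move=> h1; rewrite dotC triple_rot => w0.
    have [d2 h2 [t nt uE]] : is_dir S u by apply: (edge_direction_dir sp); apply/hs.
    have w0' : dotv (W r') (crossv d1 d2) = 0.
      by move/eqP: w0; rewrite uE crossZr dotZr mulf_eq0 (negbTE nt) => /eqP.
    have cn : crossv (crossv d1 d2) n = 0.
      apply/eqP/negPn/negP => /(hW d1 h1 d2 h2)[].
      by rewrite ![dotv (crossv _ _) _]dotC; case: hr' w0' => -> ->; rewrite eqxx.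
    have [r2 cE] : exists r2, crossv d1 d2 = r2 *: n by eexists; apply: cross_eq0P.
    rewrite uE crossZr cE; have := dot_crossr d1 d2; rewrite cE dotZr => /eqP.
    rewrite mulf_eq0 => /orP[/eqP->|d2n]; first by rewrite scale0r scaler0.
    by move: un; rewrite uE dotZl (eqP d2n) mulr0 eqxx.
  rewrite /f !germ_stable // => d1 h1 /(par _ h1) h; rewrite dotC triple_rot h dot0r //.
have others u : u \in s -> u != u0 ->
    (f r y u + f (- r) (- y) u = f r (- y) u + f (- r) y u)%N.
  move=> hu uu0; have [un|un] := eqVneq (dotv u n) 0; last first.
    by rewrite (stable r) ?(stable (- r)) //; [right|left].
  have [r1 [r2 [E1 E2 r12]]] := hsign u hu uu0 un.
  have side y' : f r y' u = f (- r) y' u.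
    have F1 := congr1 (fun q => germ S q (crossv u y')) E1.
    have F2 := congr1 (fun q => germ S q (crossv u y')) E2.
    exact: etrans F1 (etrans (germ_same_side _ _ _ r12) (esym F2)).
  have swap (i j l m : nat) : i = m -> l = j -> (i + j = l + m)%N.
    by move=> -> ->; rewrite addnC.
  exact: swap (side y) (side (- y)).
have rr : r = r \/ r = - r by left.
have rN : - r = r \/ - r = - r by right.
have yy : y = y \/ y = - y by left.
have yN : - y = y \/ - y = - y by right.
have {sum others} := sum_swap us u0s (sum _ _ rr yy) (sum _ _ rN yN) (sum _ _ rr yN) (sum _ _ rN yy) others.
rewrite /f.
have W0 t : crossv u0 (W t) = t *: n by rewrite /W crossDr crossvv add0r crossZr uz.
(* For [u0] the base normals are [r *: n] and its opposite. By central symmetry the equation says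
   that twice the germ along [d] is twice the germ along [- d]. *)
rewrite !W0 crossNr uy scaleNr germN -[germ S (- _) d]germN opprK !germ_scale // !addnn.
exact: double_inj.
Qed.

(** Ties are restricted among all points of [S], not only the active ones; the condition excludes
    finitely many lines of the plane orthogonal to [u]. *)
Definition regular_normal u v : Prop :=
  [/\ dotv v u = 0, v != 0 & forall d, d \in diffs S -> dotv v d = 0 -> crossv d u = 0].

Lemma regular_parallel u v : regular_normal u v -> act_parallel S v u.
Proof.
move=> [_ _ h] a b ha hb; apply: h; last exact: act_diff0 ha hb.
by apply: diffs_sub; [exact: act_mem ha|exact: act_mem hb].
Qed.

Lemma germ_regular u v d : u != 0 -> regular_normal u v -> dotv d u = 0 ->
  germ S v d = edge_count S v.
Proof.
move=> nu [_ _ h] du; apply: germ_stable => d' hd' /(h _ hd') hc.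
by rewrite (cross_eq0P nu hc) dotZr du mulr0.
Qed.

(** Parallel normals have equal counts by scaling and symmetry. Otherwise the segment between them
    misses the origin, [germ_sym] equates the one-sided limits along it, and [punctured_limit_const]
    applies. *)
Lemma edge_count_const u v v' : u \in s -> regular_normal u v -> regular_normal u v' ->
  edge_count S v = edge_count S v'.
Proof.
move=> hu rv rv'; have nu := direction_neq0 hu.
have [vu nv _] := rv; have [vu' nv' _] := rv'.
have [h|h] := eqVneq (crossv v v') 0.
  have vE := cross_eq0P nv' h.
  rewrite vE edge_count_scale_neq0 //.
  by apply: contraNneq nv => r0; rewrite vE r0 scale0r.
pose d := v' - v; have du : dotv d u = 0 by rewrite dotBl vu vu' subrr.
pose n t := v + t *: d.
have nE t r : n (t + r) = n t + r *: d by rewrite /n scalerDl addrA.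
have nnu t : dotv (n t) u = 0 by rewrite dotDl dotZl vu du mulr0 addr0.
have nd t : crossv (n t) d != 0.
  by rewrite crossDl crossZl crossvv scaler0 addr0 crossDr crossNr crossvv subr0.
have n0 : n 0 = v by rewrite /n scale0r addr0.
have n1 : n 1 = v' by rewrite /n scale1r addrC subrK.
rewrite -(germ_regular nu rv du) -(germ_regular nu rv' du) -n0 -n1.
apply: (@punctured_limit_const R (fun t => edge_count S (n t)) (fun t => germ S (n t) d)).
  by move=> t; apply: ev_mono (germP S (n t) d) => r _ <-; rewrite nE.
move=> t; rewrite (germ_sym hu (nnu t) du (nd t)).
by apply: ev_mono (germP S (n t) (- d)) => r _ <-; rewrite nE scalerN scaleNr.
Qed.

(** A difference orthogonal to both [v] and [crossv u v] is parallel to [u], so a small rotation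
    breaks every other tie. *)
Lemma ev_regular u v : u != 0 -> v != 0 -> dotv v u = 0 ->
  ev (fun t => regular_normal u (v + t *: crossv u v)).
Proof.
move=> nu nv vu; set z := crossv u v.
have vz : crossv v z = dotv v v *: u by rewrite cross_cross vu scale0r subr0.
have zu : dotv z u = 0 by rewrite dotC dot_crossl.
have : ev (fun t => forall d, d \in diffs S -> crossv d u != 0 -> dotv v d + t * dotv z d != 0).
  apply: ev_seq => d _; have [_|nc] := eqVneq (crossv d u) 0; first exact: ev_all.
  have h0 : dotv v d = 0 -> dotv z d != 0.
    move=> vd; apply: contraNneq nc => zd.
    have : crossv d (crossv v z) = 0 by rewrite cross_cross dotC zd dotC vd !scale0r subrr.
    by rewrite vz crossZr => /eqP; rewrite scaler_eq0 gt_eqF ?dot_gt0.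
  by apply: ev_mono (ev_lin_neq0 h0).
apply: ev_mono => t t0 h; split.
- by rewrite dotDl dotZl vu zu mulr0 addr0.
- apply/eqP => h0; have : dotv v (v + t *: z) = 0 by rewrite h0 dot0r.
  rewrite dotDr dotZr dot_crossr mulr0 addr0 => /dot_eq0 v0.
  by rewrite v0 eqxx in nv.
- move=> d hd; rewrite dotDl dotZl => h0.
  by apply/eqP/negPn/negP => /(h d hd); rewrite h0 eqxx.
Qed.

Lemma edge_count_mult u v : u \in s -> regular_normal u v ->
  edge_count S v = mult (conv S) u.
Proof.
move=> hu rv; have nu := direction_neq0 hu.
have [vu nv _] := rv.
rewrite /mult; case: asboolP => hagg.
  have ntv x : dotv x u = 0 -> nontriv S x.
    move=> xu; have : agg_cone (conv S) u x by rewrite hagg /perp dotC.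
    by move/(agg_coneP sp x nu) => [v' [nt _ sub]]; apply: nontriv_sub nt.
  by rewrite /edge_count !ntv // dotNl vu oppr0.
have [_ _ [v1 nt1 par1]] := (edge_directionP sp u).1 ((hs u).2 hu).
have [x xu hx] : exists2 x, dotv x u = 0 & ~ agg_cone (conv S) u x.
  apply: contrapT => hn; apply: hagg; apply/seteqP; split => x.
    move/(agg_coneP sp x nu) => [v' [nt par sub]].
    by rewrite /perp dotC; apply: parallel_orth nt par sub.
  by rewrite /perp dotC => xu; apply: contrapT => hx; apply: hn; exists x.
(* Zero lies in every normal cone, in particular in that of the edge with normal [v1]. *)
have nx : x != 0.
  apply/eqP => x0; apply: hx; apply/(agg_coneP sp x nu); exists v1; split => // y hy.
  by apply/actP; split; [exact: act_mem hy|move=> y' _; rewrite x0 !dot0l].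
(* A regular normal near [x] with two active points would put [x] in the aggregated cone, so one of
   the two signs contributes nothing. *)
have le1 : (edge_count S v <= 1)%N.
  have [t _ [rx sub]] := ev_ex (evI (ev_regular nu nx xu) (act_perturb S x (crossv u x))).
  rewrite (edge_count_const hu rv rx) /edge_count.
  case nt: (nontriv S (x + t *: crossv u x)); last by case: (nontriv S _).
  case: hx; apply/(agg_coneP sp x nu); exists (x + t *: crossv u x); split => //.
  exact: regular_parallel rx.
(* Rotating an edge normal [v1] slightly makes it regular without losing its active points. *)
have ge1 : (0 < edge_count S v)%N.
  have nv1 := act_parallel_neq0 sp nu par1.
  have v1u : dotv v1 u = 0 by apply: (parallel_orth nu nt1 par1).
  have zu : dotv (crossv u v1) u = 0 by rewrite dotC dot_crossl.
  have [t _ [r1 E]] := ev_ex (evI (ev_regular nu nv1 v1u) (act_rotate sp par1 zu nu)).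
  by rewrite (edge_count_const hu rv r1) /edge_count (nontriv_eq E) nt1.
by apply/eqP; rewrite eqn_leq le1 ge1.
Qed.

(** Finitely many planes are avoided one at a time, by a small move along the normal of each new
    plane. *)
Lemma exists_generic : exists w, generic S w.
Proof.
pose C := [seq crossv d d' | d <- diffs S, d' <- diffs S].
have [w hw] : exists w, forall c, c \in C -> c != 0 -> dotv w c != 0.
  elim: (C) => [|c0 C' [w hw]]; first by exists 0.
  have h0 c : c \in c0 :: C' -> ev (fun t => c != 0 -> dotv w c + t * dotv c0 c != 0).
    rewrite in_cons => hc; have [_|nc] := eqVneq c 0; first exact: ev_all.
    have h : dotv w c = 0 -> dotv c0 c != 0.
      case/orP: hc => [/eqP <- _|hc wc]; first by rewrite gt_eqF ?dot_gt0.
      by have := hw c hc nc; rewrite wc eqxx.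
    by apply: ev_mono (ev_lin_neq0 h) => t _ + _.
  have [t _ ht] := ev_ex (ev_seq h0).
  by exists (w + t *: c0) => c hc nc; rewrite dotDl dotZl; apply: ht.
exists w => d d' hd hd'; apply: hw; apply/allpairsP; by exists (d, d').
Qed.

(** For one generic [w], every [crossv u w] is a regular normal of [u], so the vertex count is the
    sum of multiplicities term by term. *)
Lemma sum_mult : (\sum_(u <- s) mult (conv S) u)%N = k.
Proof.
have [w gw] := exists_generic.
have h u : u \in s -> mult (conv S) u = edge_count S (crossv u w).
  move=> hu; have nu := direction_neq0 hu.
  have du : is_dir S u by apply: (edge_direction_dir sp); apply/hs.
  apply/esym/(edge_count_mult hu).
  split; [by rewrite dotC dot_crossl|exact (generic_cross_neq0 sp gw du nu)|].
  move=> d hd h; apply: (generic_dir gw) => //; first exact: diffs_dir.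
  by rewrite -triple_rot dotC.
by rewrite -(generic_sum gw); apply: eq_big_seq.
Qed.

End ConstancyOfEdgeCount.

(** * Finiteness of the edge directions and conclusion *)

Lemma edge_directions_finite (R : realType) (S : seq 'rV[R]_3) : spanning S ->
  exists s : seq 'rV[R]_3, uniq s /\ forall u, edge_direction (conv S) u <-> u \in s.
Proof.
move=> sp.
pose unit (d : 'rV[R]_3) := (Num.sqrt (dotv d d))^-1 *: d.
pose D := [seq unit d | d <- diffs S].
exists (undup [seq u <- D ++ map -%R D | `[< edge_direction (conv S) u >]]).
split; first exact: undup_uniq.
move=> u; rewrite mem_undup mem_filter; split; last by case/andP => /asboolP.
move=> hu; apply/andP; split; first exact/asboolP.
have [uu _ _] := (edge_directionP sp u).1 hu.
have [d hd [r nr uE]] := edge_direction_dir sp hu.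
have dd : 1 = r ^+ 2 * dotv d d by rewrite -uu uE dotZl dotZr; ring.
have dE : dotv d d = `|r^-1| ^+ 2.
  by rewrite real_normK ?num_real // exprVn -[LHS](mulKf (_ : r ^+ 2 != 0)) -?dd ?mulr1 // expf_neq0.
have uD : unit d = `|r| *: d by rewrite /unit dE sqrtr_sqr normr_id normfV invrK.
rewrite mem_cat; apply/orP.
case: (ltgtP r 0) nr => // r0 _.
  right; apply/mapP; exists (unit d); first exact: map_f.
  by rewrite uD uE ltr0_norm // scaleNr opprK.
by left; apply/mapP; exists d => //; rewrite uD uE gtr0_norm.
Qed.

Theorem theorem4p2 (R : realType) (P : set 'rV[R]_3) :
  is_polytope P -> affdim P 3 -> equiprojective P ->
  exists s : seq 'rV[R]_3,
    uniq s /\ (forall u, edge_direction P u <-> u \in s) /\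
    k_equiprojective P (\sum_(u <- s) mult P u)%N.
Proof.
move=> [S ->] /affdim3_spanning sp [k hk].
have [s [us hs]] := edge_directions_finite sp.
by exists s; split => //; split => //; rewrite (sum_mult sp us hs hk).
Qed.
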